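(* For every integer $k\ge0$, the $3$-braid $\Delta^2\sigma_1\sigma_2^{-k}\in B_3$ satisfies $\psi(\Delta^2\sigma_1\sigma_2^{-k})\neq0$ when computed in Khovanov homology with coefficients in $\mathbb{Q}$, in $\mathbb{Z}$ and in $\mathbb{Z}/2\mathbb{Z}$, and $\psi'(\Delta^2\sigma_1\sigma_2^{-k})\neq0$.
   Context: $B_3$ is the braid group with generators $\sigma_1,\sigma_2$ and $\Delta^2=(\sigma_1\sigma_2)^3$. $\psi(\beta)$ is Plamenevskaya's transverse invariant of the closure $\hat\beta$: in the Khovanov complex of the closed braid diagram (generators: Kauffman states with circles labelled $v_\pm$; homological grading $i=r-n_-$, quantum grading $j=p+i+n_+-n_-$, standard merge/split differential), it is the homology class of the generator in the oriented resolution (the $0$-resolution at positive crossings, the $1$-resolution at negative crossings) labelling every circle $v_-$. $\psi'(\beta)$ is the analogous class in reduced Khovanov homology over $\mathbb{Z}/2\mathbb{Z}$ (quotient by generators labelling the circle through a marked point $v_-$), labelling the marked circle $v_+$ and all other circles $v_-$. *)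

(* Defs.v *)
From mathcomp Require Import all_boot all_order all_algebra.
Set Implicit Arguments.
Unset Strict Implicit.
Unset Printing Implicit Defensive.
Import GRing.Theory.
Local Open Scope ring_scope.

(* A letter of a 3-braid word: (positive?, i) stands for sigma_{i+1}^{+1}
   if positive, sigma_{i+1}^{-1} otherwise (i : 'I_2, so sigma_1 or sigma_2). *)
Definition letter := (bool * 'I_2)%type.
Definition sig1 : letter := (true, 0%R).
Definition sig2 : letter := (true, 1%R).
Definition sig2inv : letter := (false, 1%R).

(* Delta^2 sigma_1 sigma_2^{-k} = (sigma_1 sigma_2)^3 sigma_1 sigma_2^{-k}. *)
Definition twist_word (k : nat) : seq letter :=
  flatten (nseq 3 [:: sig1; sig2]) ++ sig1 :: nseq k sig2inv.

Section Khovanov.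
Variable w : seq letter.
Local Notation m := (size w).

(* Points of the closed braid diagram: strand position p in {0,1,2} at level t;
   crossing number t (the t-th letter) lies between levels t and t+1 (mod m),
   the closure identifying level m with level 0. Every arc of the diagram
   contains such a point. *)
Definition vert := ('I_3 * 'I_m)%type.
Definition resol := {ffun 'I_m -> bool}.   (* false = 0-resolution, true = 1-resolution *)
Definition labelling := {ffun vert -> bool}. (* true = v_+, false = v_- *)
Definition estate := (resol * labelling)%type.

Definition lett (t : 'I_m) : letter := nth sig1 w t.
Definition posc (t : 'I_m) : bool := (lett t).1.
Definition lo (t : 'I_m) : 'I_3 := widen_ord (leqnSn 2) (lett t).2.
Definition hi (t : 'I_m) : 'I_3 := lift ord0 (lett t).2.

(* In the resolution s, crossing t is resolved "vertically" (the oriented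
   smoothing, following the strands) iff it is the 0-resolution of a positive
   crossing or the 1-resolution of a negative crossing. *)
Definition vertical (s : resol) (t : 'I_m) : bool := s t == ~~ posc t.

Definition level_edge (s : resol) (t : 'I_m) (u v : vert) : bool :=
  let t' := ordS t in
  [|| [&& u.1 != lo t, u.1 != hi t, u == (u.1, t) & v == (u.1, t')],
      vertical s t && [|| (u == (lo t, t)) && (v == (lo t, t'))
                        | (u == (hi t, t)) && (v == (hi t, t'))]
    | ~~ vertical s t && [|| (u == (lo t, t)) && (v == (hi t, t))
                           | (u == (lo t, t')) && (v == (hi t, t'))]].

Definition edge (s : resol) (u v : vert) : bool :=
  [exists t, level_edge s t u v || level_edge s t v u].

Definition circ (s : resol) (u v : vert) : bool := connect (edge s) u v.

Definition valid (x : estate) : bool :=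
  [forall u, forall v, circ x.1 u v ==> (x.2 u == x.2 v)].

(* Representatives of the (one or two) circles passing through crossing t. *)
Definition e1 (s : resol) (t : 'I_m) : vert := (lo t, t).
Definition e2 (s : resol) (t : 'I_m) : vert :=
  if vertical s t then (hi t, t) else (lo t, ordS t).

(* Matrix coefficients (0/1) of the Frobenius multiplication m and
   comultiplication Delta in the basis v_+ (true), v_- (false):
   m(v+ v+) = v+, m(v+ v-) = m(v- v+) = v-, m(v- v-) = 0,
   Delta(v+) = v+ v- + v- v+, Delta(v-) = v- v-. *)
Definition mcoef (a b z : bool) : bool :=
  match a, b with
  | true, true => z
  | true, false | false, true => ~~ z
  | false, false => false
  end.
Definition dcoefs (a x y : bool) : bool :=
  if a then x != y else ~~ x && ~~ y.

Definition flip (s : resol) (c : 'I_m) : resol :=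
  [ffun c' => if c' == c then true else s c'].

(* Local edge map at crossing c, from x (with s c = 0) to y (resolution s with c
   changed to 1): identity on circles not meeting c, merge or split at c. *)
Definition local (c : 'I_m) (x y : estate) : bool :=
  let s := x.1 in let l := x.2 in let s' := y.1 in let l' := y.2 in
  [forall v, (~~ circ s (e1 s c) v && ~~ circ s (e2 s c) v) ==> (l v == l' v)] &&
  (if circ s (e1 s c) (e2 s c)
   then dcoefs (l (e1 s c)) (l' (e1 s' c)) (l' (e2 s' c))
   else mcoef (l (e1 s c)) (l (e2 s c)) (l' (e1 s' c))).

Variable R : nzRingType.

Definition esign (s : resol) (c : 'I_m) : R :=
  (-1) ^+ #|[pred c' : 'I_m | (c' < c)%N && s c']|.

Definition dcoef (x y : estate) : R :=
  if valid x && valid y then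
    \sum_(c : 'I_m | ~~ x.1 c && (y.1 == flip x.1 c)) esign x.1 c * (local c x y)%:R
  else 0.

(* Chains: R-valued functions on enhanced states (invalid states never occur
   in the image of the differential nor in psi). *)
Definition chain := estate -> R.
Definition khd (f : chain) : chain := fun y => \sum_(x : estate) f x * dcoef x y.

Definition s_or : resol := [ffun c => ~~ posc c].

Definition psi_state : estate := (s_or, [ffun _ => false]).
Definition psi : chain := fun z => (z == psi_state)%:R.

Definition psi_nonzero : Prop :=
  (forall z, khd psi z = 0) /\ ~ (exists f : chain, forall z, khd f z = psi z).

(* Reduced version with marked point v0: quotient of the complex by the span of
   generators labelling the marked circle v_-.  Generator of psi': marked
   circle v_+, all other circles v_-. *)
Definition psi'_state (v0 : vert) : estate := (s_or, [ffun u => circ s_or v0 u]).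
Definition psi' (v0 : vert) : chain := fun z => (z == psi'_state v0)%:R.

Definition psi'_nonzero (v0 : vert) : Prop :=
  (forall z : estate, z.2 v0 -> khd (psi' v0) z = 0) /\
  ~ (exists f : chain, forall z : estate, z.2 v0 -> khd f z = psi' v0 z).

End Khovanov.

(* Main.v *)
Require Import Defs.
From mathcomp Require Import all_boot all_order all_algebra zify.
Set Implicit Arguments.
Unset Strict Implicit.
Unset Printing Implicit Defensive.
Import GRing.Theory.
Local Open Scope ring_scope.

(** The class psi is a cycle because every edge leaving the oriented resolution
    merges two circles labelled v_-.  It is not a boundary because some integral
    cocycle phi takes the value 1 on it; reducing phi modulo the characteristic
    handles all coefficient rings at once.

    The cocycle comes from simplifying the tail sigma_2^{-k}: up to homotopy its
    complex is a chain E -> ... -> E -> I, in which I stands for the vertical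
    resolution and E for the horizontal one.  The projection onto this chain is
    explicit: a resolution of the tail with j horizontal crossings, which encloses
    j - 1 circles, is sent up to sign to the j-th copy of E if all these circles are
    labelled v_-, and to 0 otherwise.  Hence phi can be taken as this projection
    followed by a cocycle depending only on the resolution and labelling of the seven
    crossings of Delta^2 sigma_1, with the tail closed up by E or I.  In homological
    degree 0 the number j of copies of E equals the number of 1-resolved crossings
    among these seven, so the remaining condition does not depend on k; a solution
    with 14 terms was found by linear algebra and is verified by computation.

    For psi', multiplication by v_- at the marked point is a chain map that factors
    through the reduced complex and sends psi' to psi. *)

(** * Circles and the differential of a closed braid diagram *)

Section Diagram.
Variable w : seq letter.
Local Notation m := (size w).
Implicit Types (s : resol w) (c t : 'I_m) (u v : vert w) (l : labelling w).

Lemma edge_sym s : symmetric (edge s).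
Proof. by move=> u v; apply: eq_existsb => t; rewrite orbC. Qed.

Lemma circ_sym s : symmetric (circ s).
Proof. exact/sym_connect_sym/edge_sym. Qed.

Lemma circ_refl s : reflexive (circ s).
Proof. exact: connect0. Qed.

Lemma circ_trans s : transitive (circ s).
Proof. exact: connect_trans. Qed.

Lemma circ_left s u v : circ s u v -> circ s u =1 circ s v.
Proof. exact: (left_trans (circ_sym s) (circ_trans (s := s))). Qed.

Lemma circ_right s u v : circ s u v -> forall q, circ s q u = circ s q v.
Proof. by move=> uv q; rewrite ![circ s q _]circ_sym; apply: circ_left. Qed.

Lemma level_circ s t u v : level_edge s t u v -> circ s u v.
Proof. by move=> e; apply: connect1; apply/existsP; exists t; rewrite e. Qed.

(** The tool for telling circles apart: exhibit a function that is constant along arcs and differs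
    at the two points. *)
Lemma circ_inv (T : Type) s (F : vert w -> T) :
    (forall t u v, level_edge s t u v -> F u = F v) ->
  forall u v, circ s u v -> F u = F v.
Proof.
move=> inv u v /connectP[p + ->]; elim: p u => //= x p IH u /andP[+ /IH<-].
by case/existsP=> t /orP[/inv | /inv].
Qed.

Lemma lo_neq_hi t : (lo t == hi t) = false.
Proof. by apply/eqP=> /(congr1 val) /=; rewrite /bump /= => /n_Sn. Qed.

Lemma circ_straight s t p : (p != lo t) -> (p != hi t) -> circ s (p, t) (p, ordS t).
Proof. by move=> h1 h2; apply: (@level_circ _ t); rewrite /level_edge /= h1 h2 !eqxx. Qed.

Lemma circ_vertical s t p : vertical s t -> circ s (p, t) (p, ordS t).
Proof.
move=> ver; have [->|nlo] := eqVneq p (lo t).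
  by apply: (@level_circ _ t); rewrite /level_edge ver !eqxx /= ?orbT.
have [->|nhi] := eqVneq p (hi t).
  by apply: (@level_circ _ t); rewrite /level_edge ver !eqxx /= ?orbT.
exact: circ_straight.
Qed.

Lemma circ_horizontal s t : ~~ vertical s t ->
  circ s (lo t, t) (hi t, t) /\ circ s (lo t, ordS t) (hi t, ordS t).
Proof.
by move=> hor; split; apply: (@level_circ _ t);
  rewrite /level_edge (negbTE hor) !eqxx /= ?orbT.
Qed.

(* Flipping crossing [c] changes no circle away from the four ends of [c]. *)
Definition touch s c v := circ s (e1 s c) v || circ s (e2 s c) v.

Definition corner c u := (u == (lo c, c)) || (u == (hi c, c)) ||
  (u == (lo c, ordS c)) || (u == (hi c, ordS c)).

(** Either smoothing joins the four ends of [c] in two pairs, and [e1], [e2] choose one end from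
    each pair. *)
Lemma corner_touch s c u : corner c u -> touch s c u.
Proof.
rewrite /touch /e1 /e2 => /orP[/orP[/orP[]|]|] /eqP ->.
- by rewrite circ_refl.
- case: ifP => [_|/negbT/circ_horizontal[-> //]]; by rewrite circ_refl orbT.
- case: ifP => [/circ_vertical-> //|_]; by rewrite circ_refl orbT.
- case: ifP => [/circ_vertical-> //|/negbT/circ_horizontal[_ -> //]]; by rewrite orbT.
Qed.

Lemma e1_corner s c : corner c (e1 s c).
Proof. by rewrite /corner /e1 eqxx. Qed.

Lemma e2_corner s c : corner c (e2 s c).
Proof. by rewrite /corner /e2; case: ifP; rewrite eqxx ?orbT. Qed.

Lemma touch_circ s c u v : circ s u v -> touch s c u = touch s c v.
Proof. by move=> uv; rewrite /touch !(circ_right uv). Qed.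

Lemma level_edge_other s1 s2 t u v :
  s1 t = s2 t -> level_edge s1 t u v = level_edge s2 t u v.
Proof. by rewrite /level_edge /vertical => ->. Qed.

Lemma level_edge_corner s1 s2 t u v : level_edge s1 t u v ->
  level_edge s2 t u v \/ corner t u /\ corner t v.
Proof.
rewrite /level_edge /corner; case/or3P=> [->|/andP[_]|/andP[_]]; first by left.
all: by case/orP=> /andP[-> ->]; right; rewrite ?orbT.
Qed.

Section TwoResolutions.
Variables (s1 s2 : resol w) (c : 'I_m).
Hypothesis eq12 : forall t, t != c -> s1 t = s2 t.

(** [touch s2 c] is constant along each arc of [s1]: the arc either belongs to [s2] as well or joins
    two corners of [c], which are always touched. *)
Lemma touch_change v : touch s1 c v -> touch s2 c v.
Proof.
suff inv t u q : level_edge s1 t u q -> touch s2 c u = touch s2 c q.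
  by case/orP=> /(circ_inv inv) <-; apply: corner_touch; rewrite ?e1_corner ?e2_corner.
have [->|tc] := eqVneq t c => e.
  by case: (level_edge_corner s2 e) => [/level_circ/touch_circ|[cu cq]] //;
    rewrite !corner_touch.
by apply/touch_circ/(@level_circ _ t); rewrite -(level_edge_other _ _ (eq12 tc)).
Qed.

Lemma untouched_change u v : ~~ touch s1 c u -> circ s1 u v -> circ s2 u v.
Proof.
(* The disjunct [touch] makes the invariant trivial on circles through [c]; all other arcs are
   common to [s1] and [s2]. *)
move=> nu uv; suff: touch s1 c u || circ s2 u u = touch s1 c v || circ s2 u v.
  by rewrite circ_refl -(touch_circ _ uv) (negbTE nu) /= => <-.
apply: (circ_inv (F := fun x => touch s1 c x || circ s2 u x) _ uv) => t a b e; have -> := touch_circ c (level_circ e).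
case: (boolP (touch s1 c b)) => //= nb; apply: circ_right.
apply: (@level_circ _ t); have [tc|tc] := eqVneq t c; last first.
  by rewrite -(level_edge_other _ _ (eq12 tc)).
move: e; rewrite tc => /(level_edge_corner s2)[//|[_ /(corner_touch s1)]].
by rewrite (negbTE nb).
Qed.

End TwoResolutions.

Lemma flipE s c t : flip s c t = (t == c) || s t.
Proof. by rewrite ffunE; case: eqP. Qed.

Lemma flip_other s c t : t != c -> s t = flip s c t.
Proof. by rewrite flipE => /negbTE->. Qed.

Lemma touch_flip s c : touch s c =1 touch (flip s c) c.
Proof.
move=> v; apply/idP/idP; apply: touch_change => t tc; first exact: flip_other.
by rewrite -flip_other.
Qed.

Lemma untouched_flip s c u v : ~~ touch s c u -> circ s u v = circ (flip s c) u v.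
Proof.
move=> nu; apply/idP/idP; first by apply: untouched_change nu => t; apply: flip_other.
by apply: (@untouched_change _ _ c) => [t /(flip_other s)->//|]; rewrite -touch_flip.
Qed.

Lemma validP s l : reflect (forall u v, circ s u v -> l u = l v) (valid (s, l)).
Proof.
apply: (iffP forallP) => [H u v uv|H u].
  by have /forallP/(_ v)/implyP/(_ uv)/eqP := H u.
by apply/forallP=> v; apply/implyP=> /H->.
Qed.

(** When the two circles at [c] coincide, [b] is ignored; [patch_ok] then asks for [a == b], so each
    labelling comes from one pair. *)
Definition patch s c l (a b : bool) : labelling w :=
  [ffun v => if circ s (e1 s c) v then a else if circ s (e2 s c) v then b else l v].

Definition edge_coef s c l (a b : bool) : bool :=
  if circ s (e1 s c) (e2 s c) then dcoefs (l (e1 s c)) a b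
  else mcoef (l (e1 s c)) (l (e2 s c)) a.

Definition patch_ok s c l (a b : bool) : bool :=
  (circ (flip s c) (e1 (flip s c) c) (e2 (flip s c) c) ==> (a == b))
    && edge_coef s c l a b.

(** Circles away from [c] keep their labels, so a target of the edge map is determined by its values
    at [e1] and [e2] after the flip. *)
Lemma sum_local (V : nmodType) s c l (F : labelling w -> V) : valid (s, l) ->
  \sum_(l' | valid (flip s c, l') && local c (s, l) (flip s c, l')) F l' =
  \sum_a \sum_b (if patch_ok s c l a b then F (patch (flip s c) c l a b) else 0).
Proof.
move=> /validP vl; set s' := flip s c.
rewrite pair_big /=.
rewrite (partition_big (fun l' : labelling w => (l' (e1 s' c), l' (e2 s' c))) predT) //=.
apply: eq_bigr => -[a b] _ /=; set G := patch s' c l a b.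
have G1 : G (e1 s' c) = a by rewrite ffunE circ_refl.
have G2 : (circ s' (e1 s' c) (e2 s' c) ==> (a == b)) -> G (e2 s' c) = b.
  by rewrite ffunE circ_refl; case: ifP => //= _ /eqP.
have uniqG l' : valid (s', l') -> local c (s, l) (s', l') ->
    l' (e1 s' c) = a -> l' (e2 s' c) = b -> l' = G.
  move=> /validP vl' /andP[/forallP /= H _] h1 h2; apply/ffunP=> v; rewrite ffunE.
  case: ifP => [/vl'<- //|n1]; case: ifP => [/vl'<- //|n2].
  have := touch_flip s c v; rewrite /touch n1 n2 /= => /norP[k1 k2].
  by have := H v; rewrite k1 k2 /= => /eqP->.
case: ifPn => [/andP[ok1 ok2]|nok].
  rewrite (big_pred1 G) // => l' /=; apply/idP/eqP.
    by case/andP=> /andP[v1 v2] /eqP[h1 h2]; apply: uniqG.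
  move=> ->; rewrite G1 (G2 ok1) !eqxx andbT; apply/andP; split.
    apply/validP=> u v uv; rewrite !ffunE -!(circ_right uv).
    case: ifP => // n1; case: ifP => // n2; apply: vl.
    by rewrite (@untouched_flip s c) // touch_flip /touch n1 n2.
  rewrite /local /= -/s' G1 (G2 ok1); apply/andP; split => //.
  apply/forallP=> v; apply/implyP=> /andP[k1 k2]; rewrite ffunE.
  have := touch_flip s c v; rewrite /touch (negbTE k1) (negbTE k2) /=.
  by case/esym/norP=> /negbTE-> /negbTE->.
rewrite big_pred0 // => l'; apply/negbTE/negP=> /andP[/andP[v1 v2] /eqP[h1 h2]].
case/negP: nok; apply/andP; split.
  by apply/implyP=> /(validP _ _ v1); rewrite h1 h2 => ->.
by case/andP: v2 => _ /=; rewrite -/s' h1 h2.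
Qed.

(** Brings the coboundary of [phi] into the shape used on the front: at most four terms per
    0-resolved crossing. *)
Lemma sum_dcoef (R : nzRingType) (x : estate w) (phi : estate w -> R) : valid x ->
  \sum_y dcoef R x y * phi y =
  \sum_(c | ~~ x.1 c) esign R x.1 c * \sum_a \sum_b
    (if patch_ok x.1 c x.2 a b
     then phi (flip x.1 c, patch (flip x.1 c) c x.2 a b) else 0).
Proof.
move=> vx; transitivity (\sum_y \sum_(c | ~~ x.1 c) (if valid y && (y.1 == flip x.1 c)
    && local c x y then esign R x.1 c * phi y else 0)).
  apply: eq_bigr => y _; rewrite /dcoef vx /=; case: ifP => vy; last first.
    by rewrite mul0r big1.
  rewrite big_distrl /= big_mkcondr /=; apply: eq_bigr => c _.
  case: ifP => //= _; case: (local _ _ _); by rewrite ?mulr1 // mulr0 mul0r.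
rewrite exchange_big /=; apply: eq_bigr => c _.
case: x vx => s l vx /=; rewrite -(sum_local c (fun l' => phi (flip s c, l')) vx).
rewrite -big_mkcond big_distrr /=.
rewrite (reindex_onto (fun l' => (flip s c, l')) (fun y => y.2)) /=.
  by apply: eq_bigl => l'; rewrite !eqxx !andbT.
by move=> [s' l'] /andP[/andP[_ /eqP /= ->]].
Qed.

End Diagram.

(** * Transverse cycles *)

Section Plamenevskaya.
Variable w : seq letter.
Local Notation m := (size w).
Implicit Types (s : resol w) (c t : 'I_m) (u v : vert w) (l : labelling w).

Lemma s_or_vertical t : vertical (s_or w) t.
Proof. by rewrite /vertical ffunE eqxx. Qed.

Lemma circ_s_or u v : circ (s_or w) u v -> u.1 = v.1.
Proof.
apply: circ_inv => t a b; rewrite /level_edge s_or_vertical /= orbF.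
by case/orP=> [/and4P[_ _ _ /eqP->]|/orP[] /andP[/eqP-> /eqP->]].
Qed.

Lemma s_or_merge c : circ (s_or w) (e1 (s_or w) c) (e2 (s_or w) c) = false.
Proof.
apply/negP=> /circ_s_or; rewrite /e1 /e2 s_or_vertical /= => /eqP.
by rewrite lo_neq_hi.
Qed.

Lemma psi_valid : valid (psi_state w).
Proof. by apply/validP=> u v _; rewrite !ffunE. Qed.

Section Coefficients.
Variable R : nzRingType.

Lemma khd_delta (x0 z : estate w) :
  khd (fun x => (x == x0)%:R : R) z = dcoef R x0 z.
Proof.
rewrite /khd (bigD1 x0) //= eqxx mul1r big1 ?addr0 // => x /negbTE->.
by rewrite mul0r.
Qed.

Lemma dcoef0 (x y : estate w) :
    (forall c, ~~ x.1 c -> y.1 = flip x.1 c -> valid x -> valid y -> ~~ local c x y) ->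
  dcoef R x y = 0.
Proof.
move=> H; rewrite /dcoef; case: ifP => // /andP[vx vy].
by apply: big1 => c /andP[xc /eqP yc]; rewrite (negbTE (H c xc yc vx vy)) mulr0.
Qed.

Lemma psi_cycle z : khd (@psi w R) z = 0.
Proof.
rewrite khd_delta; apply: dcoef0 => c _ _ _ _.
by rewrite /local /= s_or_merge !ffunE /= andbF.
Qed.

(** Pair a bounding relation with [phi]: the boundary side moves the differential onto [phi] and
    gives 0, the other side gives 1. *)
Lemma cocycle_nonboundary (phi : estate w -> R) x0 :
    (forall x, \sum_y dcoef R x y * phi y = 0) -> phi x0 = 1 ->
  ~ (exists f : chain w R, forall z, khd f z = (z == x0)%:R).
Proof.
move=> coc phi1 [f Hf]; have /eqP[] := oner_neq0 R.
transitivity (\sum_z khd f z * phi z).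
  rewrite (bigD1 x0) //= big1 => [|z /negbTE zx0]; first by rewrite Hf eqxx addr0 mul1r.
  by rewrite Hf zx0 mul0r.
rewrite (eq_bigr (fun z => \sum_x f x * dcoef R x z * phi z)); last first.
  by move=> z _; rewrite big_distrl.
rewrite exchange_big big1 //= => x _.
by under eq_bigr do rewrite -mulrA; rewrite -mulr_sumr coc mulr0.
Qed.

End Coefficients.

(* Changing a resolution always merges two circles or splits one. *)
Definition planar := forall s c, ~~ s c ->
  circ s (e1 s c) (e2 s c) = ~~ circ (flip s c) (e1 (flip s c) c) (e2 (flip s c) c).

Hypothesis w_planar : planar.
Variable v0 : vert w.

(** Subcomplex property: v_- spans an ideal, and Delta(v_-) = v_- v_-. Planarity puts both
    representatives on one circle after a merge. *)
Lemma local_marked_minus c (x y : estate w) : ~~ x.1 c -> y.1 = flip x.1 c ->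
  valid x -> valid y -> local c x y -> ~~ x.2 v0 -> ~~ y.2 v0.
Proof.
case: x y => s l [s' l'] /= sc -> {s'} /validP vl /validP vl' /andP[/= /forallP H loc] n0.
have pl := w_planar sc.
case: (boolP (touch s c v0)) => [tch|/norP[n1 n2]]; last first.
  by have := H v0; rewrite n1 n2 /= => /eqP<-.
move: loc; case: ifP => [sp|mg].
  have -> : l (e1 s c) = false.
    apply/negbTE; case/orP: tch => [/vl->//|]; by rewrite -(circ_left sp) => /vl->.
  rewrite /dcoefs => /andP[h1 h2].
  by move: tch; rewrite touch_flip => /orP[] /vl' <-.
have e12 : circ (flip s c) (e1 (flip s c) c) (e2 (flip s c) c).
  by apply/negPn; rewrite -pl mg.
have <- : l' (e1 (flip s c) c) = l' v0.
  by move: tch; rewrite touch_flip => /orP[/vl'//|]; rewrite -(circ_left e12) => /vl'.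
by case/orP: tch => /vl->; rewrite (negbTE n0); case: (l _) => //=.
Qed.

Lemma dcoef_marked_minus (R : nzRingType) (x y : estate w) :
  ~~ x.2 v0 -> y.2 v0 -> dcoef R x y = 0.
Proof.
move=> x0 y0; apply: dcoef0 => c xc yc vx vy; apply: contraTN y0 => loc.
exact: (local_marked_minus xc yc vx vy loc).
Qed.

Definition set_marked (b : bool) (x : estate w) : estate w :=
  (x.1, [ffun v => if circ x.1 v0 v then b else x.2 v]).

Lemma set_marked_valid b x : valid x -> valid (set_marked b x).
Proof.
case: x => s l /validP vl; apply/validP=> u v uv.
by rewrite !ffunE -(circ_right uv) (vl _ _ uv).
Qed.

Lemma set_marked_at b x : (set_marked b x).2 v0 = b.
Proof. by rewrite ffunE circ_refl. Qed.

Lemma set_markedK b b' x : valid x -> x.2 v0 = b -> set_marked b (set_marked b' x) = x.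
Proof.
case: x => s l /validP vl /= l0; congr pair; apply/ffunP=> v; do 2!rewrite ffunE /=.
by case: (boolP (circ s v0 v)) => [/vl<-|//]; rewrite l0.
Qed.

(** Merges and splits commute with multiplication by v_- at the marked point, which identifies the
    quotient (marked v_+) with the subcomplex (marked v_-). *)
Lemma local_set_marked c (x y : estate w) : ~~ x.1 c -> y.1 = flip x.1 c ->
    valid x -> valid y -> ~~ x.2 v0 -> ~~ y.2 v0 ->
  local c (set_marked true x) (set_marked true y) = local c x y.
Proof.
case: x y => s l [s' l'] /= sc -> {s'} /validP vl /validP vl' /negbTE x0 /negbTE y0.
have pl := w_planar sc; rewrite /local /=; set s' := flip s c in pl vl' *.
congr andb.
  apply: eq_forallb => v; case: (boolP (circ s _ v)) => //= n1.
  case: (boolP (circ s _ v)) => //= n2; rewrite !ffunE.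
  have nt : ~~ touch s c v by rewrite /touch negb_or n1 n2.
  have <- : circ s v0 v = circ s' v0 v by rewrite !(circ_sym _ v0); apply: untouched_flip.
  case: ifP => // v0v; rewrite eqxx -(vl _ _ v0v) x0 -(vl' v0) ?y0 //.
  by rewrite circ_sym -untouched_flip // circ_sym.
have lE v : circ s v0 v -> l v = false by move/vl<-.
have lE' v : circ s' v0 v -> l' v = false by move/vl'<-.
rewrite !ffunE; have := touch_flip s c v0; rewrite /touch -/s'.
rewrite !(circ_sym _ _ v0); case: ifP pl => [sp|mg] pl.
  have /negbTE pl' : ~~ circ s' (e1 s' c) (e2 s' c) by rewrite -pl.
  rewrite -(circ_right sp) orbb.
  case: ifP => [h1 /esym/orP[] h2|h1 /esym/negbT/norP[/negbTE-> /negbTE->] //].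
    rewrite h2 (lE _ h1) (lE' _ h2); case: ifP => [h3|_] /=; last by [].
    by rewrite -(circ_left h2) h3 in pl'.
  rewrite h2 (lE _ h1) (lE' _ h2); case: ifP => [h3|_] /=; last by rewrite andbT; case: (l' _).
  by rewrite -(circ_left h3) h2 in pl'.
have e12 : circ s' (e1 s' c) (e2 s' c) by apply/negPn; rewrite -pl.
rewrite -(circ_right e12) orbb.
case: ifP => [h1|h1]; case: ifP => [h2|h2] //= h3; rewrite -h3.
- by rewrite -(circ_left h1) h2 in mg.
- by rewrite (lE _ h1) (lE' _ (esym h3)); case: (l _).
- by rewrite (lE _ h2) (lE' _ (esym h3)); case: (l _).
- by [].
Qed.

Lemma dcoef_set_marked (R : nzRingType) (x y : estate w) :
    valid x -> valid y -> ~~ x.2 v0 -> ~~ y.2 v0 ->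
  dcoef R (set_marked true x) (set_marked true y) = dcoef R x y.
Proof.
move=> vx vy x0 y0; rewrite /dcoef vx vy !set_marked_valid //=.
by apply: eq_bigr => c /andP[xc /eqP yc]; rewrite local_set_marked.
Qed.

(** Every edge merges two circles. The product v_- v_- is 0, and if one of them is the marked
    circle, v_+ v_- = v_- vanishes in the quotient. *)
Lemma psi'_cycle (R : nzRingType) (z : estate w) : z.2 v0 -> khd (@psi' w R v0) z = 0.
Proof.
move=> z0; rewrite khd_delta; apply: dcoef0 => c sc zc vx vz.
apply/negP=> /andP[/= /forallP H]; rewrite s_or_merge.
have n12 : circ (s_or w) v0 (e1 (s_or w) c) && circ (s_or w) v0 (e2 (s_or w) c) = false.
  by apply/negP=> /andP[h1]; rewrite (circ_left h1) s_or_merge.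
have e12 := w_planar sc; rewrite s_or_merge in e12; move/esym/negbFE: e12 => e12.
rewrite !ffunE zc /=; case: z z0 zc vz H => s' l' /= z0 -> /validP vz H.
set s1 := flip _ c in e12 vz *.
have tch : touch (s_or w) c v0 -> l' (e1 s1 c) = l' v0.
  by rewrite touch_flip => /orP[/vz//|]; rewrite -(circ_left e12) => /vz.
move: tch n12; rewrite /touch !(circ_sym _ _ v0) z0.
by case: (circ _ v0 (e1 _ c)); case: (circ _ v0 (e2 _ c)) => //= ->.
Qed.

Lemma psi'_nonboundary (R : nzRingType) :
    ~ (exists f : chain w R, forall z, khd f z = @psi w R z) ->
  ~ (exists f : chain w R, forall z : estate w, z.2 v0 -> khd f z = @psi' w R v0 z).
Proof.
move=> nb [f Hf]; apply: nb.
(* The image of [f] under multiplication by v_- at the marked point. *)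
exists (fun x => if valid x && ~~ x.2 v0 then f (set_marked true x) else 0) => z.
have psi0 : (psi_state w).2 v0 = false by rewrite ffunE.
case: (boolP (valid z)) => [vz|nz]; last first.
  rewrite /psi; case: eqP nz => [->|_ nz]; first by rewrite psi_valid.
  by apply: big1 => x _; rewrite /dcoef (negbTE nz) andbF mulr0.
case: (boolP (z.2 v0)) => z0.
  rewrite /psi; case: eqP z0 => [->|_ z0]; first by rewrite psi0.
  apply: big1 => x _; case: ifP => [/andP[_ x0]|_]; last by rewrite mul0r.
  by rewrite dcoef_marked_minus ?mulr0.
transitivity (khd f (set_marked true z)); last first.
  rewrite Hf ?set_marked_at // /psi' /psi; congr (_%:R).
  have E : psi'_state v0 = set_marked true (psi_state w).
    by congr pair; apply/ffunP=> v; rewrite !ffunE; case: ifP.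
  rewrite E; congr nat_of_bool; apply/eqP/eqP=> [eqz|->//].
  rewrite -(set_markedK true vz (negbTE z0)) eqz.
  by rewrite (set_markedK true psi_valid psi0).
(* Generators marked v_- never map to one marked v_+, so only those marked v_+ count on the right;
   relabelling the marked circle matches them with the left side. *)
rewrite /khd; rewrite [RHS](bigID (fun x => valid x && x.2 v0)) /=.
rewrite [X in _ = _ + X]big1 ?addr0 => [|x /nandP[/negbTE nx|x0]]; first last.
- by rewrite dcoef_marked_minus ?mulr0 // set_marked_at.
- by rewrite /dcoef nx mulr0.
rewrite [RHS](reindex_onto (set_marked true) (set_marked false)) /=; last first.
  by move=> x /andP[vx x0]; rewrite set_markedK.
rewrite [LHS](bigID (fun x => valid x && ~~ x.2 v0)) /=.
rewrite [X in _ + X = _]big1 ?addr0 => [|x /negbTE->]; last by rewrite mul0r.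
apply: eq_big => x; last by move=> /andP[vx x0]; rewrite vx x0 dcoef_set_marked.
rewrite set_marked_at; case: (boolP (valid x)) => vx /=.
  rewrite set_marked_valid //=; case: (boolP (x.2 v0)) => x0 /=.
    apply/esym/negbTE; apply: contraTneq x0 => <-.
    by rewrite (set_marked_at false).
  by rewrite set_markedK ?eqxx // (negbTE x0).
apply/esym/negbTE; apply: contraNN vx => /andP[/andP[v1 _] /eqP<-].
exact: set_marked_valid.
Qed.

End Plamenevskaya.

(** * The front: the seven crossings of the positive part, with closed tail *)

(* The front is the diagram of [twist_word 1]: crossing 7 stands for the whole tail,
   1-resolved (bit [true]) when the tail resolves to I and 0-resolved when it
   resolves to E.  The point at strand [p] and level [t] is coded as [3 * t + p]. *)
Definition fv (p t : nat) : nat := (3 * t + p)%N.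
Definition flo (t : nat) : nat := odd t.
Definition fhi (t : nat) : nat := (flo t).+1.
Definition foth (t : nat) : nat := if odd t then 0%N else 2%N.
Definition fnext (t : nat) : nat := if t == 7 then 0%N else t.+1.
(** Crossing 7 is negative, hence vertical when 1-resolved; the other crossings are positive. *)
Definition fvertical (bs : seq bool) (t : nat) : bool := nth false bs t == (t == 7).

Definition fedges_at (bs : seq bool) (t : nat) : seq (nat * nat) :=
  let t' := fnext t in
  (fv (foth t) t, fv (foth t) t') ::
  if fvertical bs t
  then [:: (fv (flo t) t, fv (flo t) t'); (fv (fhi t) t, fv (fhi t) t')]
  else [:: (fv (flo t) t, fv (fhi t) t); (fv (flo t) t', fv (fhi t) t')].

Definition fedges bs := flatten [seq fedges_at bs t | t <- iota 0 8].

Definition merge_step (tb : seq nat) (e : nat * nat) : seq nat :=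
  let x := nth 0%N tb e.1 in let y := nth 0%N tb e.2 in
  [seq if z == x then y else z | z <- tb].

(** A naive union-find in which every class is named by one of its own points. *)
Definition classes bs : seq nat := foldl merge_step (iota 0 24) (fedges bs).

Definition fcirc bs (u v : nat) : bool :=
  let tb := classes bs in nth 0%N tb u == nth 0%N tb v.

Definition fe1 (t : nat) : nat := fv (flo t) t.
Definition fe2 bs (t : nat) : nat :=
  if fvertical bs t then fv (fhi t) t else fv (flo t) (fnext t).
Definition fflip (bs : seq bool) (c : nat) : seq bool :=
  mkseq (fun t => (t == c) || nth false bs t) 8.

Definition fpatch bs (lab : seq bool) (c : nat) (a b : bool) : seq bool :=
  let tb := classes bs in
  let x := nth 0%N tb (fe1 c) in let y := nth 0%N tb (fe2 bs c) in
  mkseq (fun q => let z := nth 0%N tb q in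
                  if x == z then a else if y == z then b else nth false lab q) 24.

(** On a v_+ circle through [q0] this is multiplication by v_-. *)
Definition fclear bs (lab : seq bool) (q0 : nat) : seq bool :=
  let tb := classes bs in let x := nth 0%N tb q0 in
  mkseq (fun q => if x == nth 0%N tb q then false else nth false lab q) 24.

Definition fok bs (lab : seq bool) (c : nat) (a b : bool) : bool :=
  (fcirc (fflip bs c) (fe1 c) (fe2 (fflip bs c) c) ==> (a == b)) &&
  (if fcirc bs (fe1 c) (fe2 bs c) then dcoefs (nth false lab (fe1 c)) a b
   else mcoef (nth false lab (fe1 c)) (nth false lab (fe2 bs c)) a).

(* A triple (e, r, C) contributes e at the resolution whose 1-resolved crossings
   are listed in r, on the labellings taking the values prescribed by C. *)
Definition cocycle_table : seq (int * seq nat * seq (nat * bool)) := [::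
  (1%R, [::], [:: (fv 0 0, false); (fv 1 0, false); (fv 2 0, false)]);
  ((-1)%R, [:: 1], [:: (fv 0 0, false); (fv 1 0, false); (fv 1 2, false)]);
  (1%R, [:: 1; 2], [:: (fv 0 0, false); (fv 1 0, false)]);
  ((-1)%R, [:: 0; 2], [:: (fv 0 0, false); (fv 0 1, false)]);
  (1%R, [:: 0; 1], [:: (fv 0 0, false); (fv 1 2, false)]);
  ((-1)%R, [:: 0; 2; 3], [:: (fv 0 0, false); (fv 0 1, true); (fv 1 4, false)]);
  (1%R, [:: 0; 2; 3], [:: (fv 0 0, true); (fv 0 1, false); (fv 1 4, false)]);
  ((-1)%R, [:: 0; 1; 2], [:: (fv 0 0, false)]);
  (1%R, [:: 0; 2; 3; 5],
   [:: (fv 0 0, false); (fv 0 1, true); (fv 1 4, true); (fv 1 6, false)]);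
  ((-1)%R, [:: 0; 2; 3; 5],
   [:: (fv 0 0, true); (fv 0 1, false); (fv 1 4, true); (fv 1 6, false)]);
  ((-1)%R, [:: 0; 2; 3; 5],
   [:: (fv 0 0, true); (fv 0 1, true); (fv 1 4, false); (fv 1 6, false)]);
  ((-1)%R, [:: 0; 2; 3; 5; 6], [:: (fv 0 0, false); (fv 0 1, true); (fv 1 4, true)]);
  (1%R, [:: 0; 2; 3; 5; 6], [:: (fv 0 0, true); (fv 0 1, false); (fv 1 4, true)]);
  (1%R, [:: 0; 2; 3; 5; 6], [:: (fv 0 0, true); (fv 0 1, true); (fv 1 4, false)])]%N.

(** The tail bit is left out of [r] because homological degree 0 determines it: the tail is I
    exactly when [r] is empty. *)
Definition Phi bs (lab : seq bool) : int :=
  let r := [seq t <- iota 0 7 | nth false bs t] in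
  foldr (fun e z => if (e.1.2 == r) && all (fun q => nth false lab q.1 == q.2) e.2
                    then e.1.1 + z else z) 0 cocycle_table.

Definition sum_seq (T : Type) (r : seq T) (F : T -> int) : int :=
  foldr (fun i z => F i + z) 0 r.

Definition fterm bs lab c : int :=
  let bs' := fflip bs c in
  sum_seq [:: true; false] (fun a => sum_seq [:: true; false] (fun b =>
    if fok bs lab c a b then Phi bs' (fpatch bs' lab c a b) else 0)).

Definition fweight (bs : seq bool) (c : nat) : nat := count (nth false bs) (iota 0 c).

Definition front_sum bs lab : int :=
  sum_seq [seq c <- iota 0 7 | ~~ nth false bs c]
    (fun c => (-1) ^+ fweight bs c * fterm bs lab c).

(* The maps E -> I (a saddle) and E -> E (the sum or difference of the
   multiplications by v_- at the two arcs of E) of the simplified tail. *)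
Definition tail_sum bs lab : int :=
  if fweight bs 7 == 0%N then fterm bs lab 7 else
  (if nth false lab (fv 1 7) then Phi bs (fclear bs lab (fv 1 7)) else 0) +
  (-1) ^+ fweight bs 7 *
    (if nth false lab (fv 1 0) then Phi bs (fclear bs lab (fv 1 0)) else 0).

Fixpoint allbits (n : nat) : seq (seq bool) :=
  if n is n'.+1 then [seq true :: x | x <- allbits n'] ++ [seq false :: x | x <- allbits n']
  else [:: [::]].

Lemma allbitsP n (bs : seq bool) : size bs = n -> bs \in allbits n.
Proof.
elim: n bs => [|n IH] [|b bs] //= [/IH Hbs]; rewrite mem_cat; apply/orP.
by case: b; [left | right]; apply: map_f.
Qed.

(** One bit of [lb] per circle, so that only labellings constant on circles are enumerated. *)
Definition labelling_of (tb : seq nat) (lb : seq bool) : seq bool :=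
  let rp := undup tb in [seq nth false lb (index z rp) | z <- tb].

(** The sources have homological degree -1, so their tail has [fweight bs 7 + 1] horizontal
    crossings and is never I. *)
Definition check_cocycle (bs : seq bool) : bool :=
  nth false bs 7 ||
  let tb := classes bs in
  all (fun lb => let lab := labelling_of tb lb in
         front_sum bs lab + (-1) ^+ fweight bs 7 * tail_sum bs lab == 0)
      (allbits (size (undup tb))).

(** The third test makes each class name a point of that class, where its label can be read off; the
    fourth is planarity. *)
Definition check_classes (bs : seq bool) : bool :=
  let tb := classes bs in
  [&& size tb == 24,
      all (fun e => nth 0%N tb e.1 == nth 0%N tb e.2) (fedges bs),
      all (fun q => (nth 0%N tb q < 24)%N && (nth 0%N tb (nth 0%N tb q) == nth 0%N tb q)) (iota 0 24) &
      all (fun c => nth false bs c ||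
          (fcirc bs (fe1 c) (fe2 bs c)
             != fcirc (fflip bs c) (fe1 c) (fe2 (fflip bs c) c))) (iota 0 8)].

Lemma front_classes bs : size bs = 8 -> check_classes bs.
Proof.
have: all check_classes (allbits 8) by vm_compute.
by move=> /allP H /allbitsP /H.
Qed.

Lemma front_cocycle bs : size bs = 8 -> check_cocycle bs.
Proof.
have: all check_cocycle (allbits 8) by vm_compute.
by move=> /allP H /allbitsP /H.
Qed.

(** * Circles of the twisted braid *)

(** The fold keeps equally named points equivalent, since a step identifies two names only along a
    pair related by [e]. *)
Lemma merge_sound (e : rel nat) (es : seq (nat * nat)) :
    equivalence_rel e -> all (fun a => [&& a.1 < 24, a.2 < 24 & e a.1 a.2]%N) es ->
  let tb := foldl merge_step (iota 0 24) es in
  forall u v, (u < 24)%N -> (v < 24)%N -> nth 0%N tb u = nth 0%N tb v -> e u v.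
Proof.
move=> eqe; have [er est] : reflexive e /\ (forall x y z, e x y -> e x z = e y z).
  by split=> [x|x y z]; [case: (eqe x x x) | case: (eqe x y z)].
have es' x y : e x y -> e y x by move=> xy; rewrite -(est _ _ x xy).
set tb := iota 0 24; have sz : size tb = 24%N by [].
have : forall u v, (u < 24)%N -> (v < 24)%N -> nth 0%N tb u = nth 0%N tb v -> e u v.
  by move=> u v u24 v24; rewrite !nth_iota // => /eqP; rewrite eqn_add2l => /eqP->.
elim: es tb sz => [|[a b] es IH] tb sz //= inv /andP[/and3P[/= a24 b24 ab] ok].
apply: IH ok => [|u v u24 v24]; first by rewrite size_map.
rewrite !(nth_map 0%N) ?sz //; case: eqP => [ua|_]; case: eqP => [va|_] h.
- by apply: inv; rewrite // ua va.
- have av := inv _ _ b24 v24 h; have au := inv _ _ u24 a24 ua.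
  by rewrite (est _ _ _ au) (est _ _ _ ab).
- have av := inv _ _ v24 a24 va; have au := inv _ _ u24 b24 h.
  by rewrite (est _ _ _ au); apply: es'; rewrite (est _ _ _ av).
- exact: inv.
Qed.

Lemma fedges_in bs t e : (t < 8)%N -> e \in fedges_at bs t -> e \in fedges bs.
Proof. by move=> t8 he; apply/flatten_mapP; exists t => //; rewrite mem_iota. Qed.

Lemma fedges_class bs e : size bs = 8 -> e \in fedges bs -> fcirc bs e.1 e.2.
Proof. by move=> /front_classes/and4P[_ /allP H _ _] /H. Qed.

Lemma fcirc_straight bs t : size bs = 8 -> (t < 8)%N ->
  fcirc bs (fv (foth t) t) (fv (foth t) (fnext t)).
Proof.
move=> sz t8; apply: (@fedges_class _ (_, _) sz); apply: (fedges_in t8).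
by rewrite inE eqxx.
Qed.

Lemma fcirc_vertical bs t p : size bs = 8 -> (t < 8)%N -> (p < 3)%N -> fvertical bs t ->
  fcirc bs (fv p t) (fv p (fnext t)).
Proof.
move=> sz t8 p3 ver; have [->|np] := eqVneq p (foth t); first exact: fcirc_straight.
apply: (@fedges_class _ (_, _) sz); apply: (fedges_in t8); rewrite /fedges_at ver !inE.
have [->|np1] := eqVneq p (flo t); first by rewrite eqxx orbT.
have -> : p = fhi t by move: np np1; rewrite /foth /fhi /flo; case: (odd t) => /=; lia.
by rewrite eqxx !orbT.
Qed.

Lemma fcirc_horizontal bs t : size bs = 8 -> (t < 8)%N -> ~~ fvertical bs t ->
  fcirc bs (fv (flo t) t) (fv (fhi t) t) /\
  fcirc bs (fv (flo t) (fnext t)) (fv (fhi t) (fnext t)).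
Proof.
move=> sz t8 /negbTE hor; split;
  apply: (@fedges_class _ (_, _) sz); apply: (fedges_in t8); rewrite /fedges_at hor !inE eqxx.
  by rewrite orbT.
by rewrite !orbT.
Qed.

Lemma fv_mod p t : (p < 3)%N -> (fv p t %% 3 = p)%N.
Proof. by rewrite /fv => p3; lia. Qed.
Lemma fv_div p t : (p < 3)%N -> (fv p t %/ 3 = t)%N.
Proof. by rewrite /fv => p3; lia. Qed.

Section Twist.
Variable k : nat.
Local Notation w := (twist_word k).
Local Notation m := (size w).
Implicit Types (s : resol w) (c : 'I_m) (u v : vert w) (l : labelling w).

Lemma size_twist : m = (7 + k)%N.
Proof. by rewrite size_cat /= size_nseq. Qed.

Lemma m_gt0 : (0 < m)%N. Proof. by rewrite size_twist. Qed.

Lemma m_ge7 : (7 <= m)%N. Proof. by rewrite size_twist. Qed.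

(** Level [m] wraps to level 0, as in the closure; for [k = 0] this already happens to level 7 of
    the front. *)
Definition lev (t : nat) : 'I_m := Ordinal (ltn_pmod t m_gt0).
Definition vtx (p t : nat) : vert w := (inord p, lev t).
Definition emb (q : nat) : vert w := vtx (q %% 3) (q %/ 3).

Lemma lev_val c : lev c = c.
Proof. by apply: val_inj; rewrite /= modn_small. Qed.

Lemma val_lev t : (t < m)%N -> val (lev t) = t.
Proof. by move=> tm; rewrite /= modn_small. Qed.

Lemma lev_inj t c : (t < m)%N -> (lev t == c) = (t == c :> nat).
Proof. by move=> tm; rewrite -val_eqE /= modn_small. Qed.

Lemma ordS_lev t : ordS (lev t) = lev t.+1.
Proof. by apply: val_inj; rewrite /= -addn1 modnDml addn1. Qed.

Lemma vtx_val u : vtx u.1 u.2 = u.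
Proof. by case: u => p t; rewrite /vtx inord_val lev_val. Qed.

Lemma vtx_m p : vtx p m = vtx p 0.
Proof. by congr pair; apply: val_inj; rewrite /= modnn mod0n. Qed.

Lemma emb_fv p t : (p < 3)%N -> emb (fv p t) = vtx p t.
Proof. by move=> p3; rewrite /emb fv_mod // fv_div. Qed.

Lemma lett_front c : (c < 7)%N -> lett c = (true, inord (odd c)).
Proof.
rewrite /lett; case: c => -[|[|[|[|[|[|[|//]]]]]]] //= _ _; congr pair;
  by apply: val_inj; rewrite /= inordK.
Qed.

Lemma lett_tail c : (7 <= c)%N -> lett c = sig2inv.
Proof.
move=> c7; rewrite /lett (_ : val c = (c - 7).+4.+3)%N; last by rewrite /= -{1}(subnKC c7).
rewrite /= nth_nseq; have := ltn_ord c; rewrite [X in (_ < X)%N -> _]size_twist => h.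
by rewrite ltn_subLR // h.
Qed.

Lemma lo_front c : (c < 7)%N -> val (lo c) = flo c.
Proof. by move=> c7; rewrite /lo lett_front //= inordK // /flo; case: odd. Qed.

Lemma hi_front c : (c < 7)%N -> val (hi c) = fhi c.
Proof. by move=> c7; rewrite /hi lett_front //= inordK // /flo; case: odd. Qed.

Lemma lo_tail c : (7 <= c)%N -> val (lo c) = 1%N.
Proof. by move=> c7; rewrite /lo lett_tail. Qed.

Lemma hi_tail c : (7 <= c)%N -> val (hi c) = 2%N.
Proof. by move=> c7; rewrite /hi lett_tail. Qed.

Lemma lo_tail1 c : (7 <= c)%N -> lo c = inord 1.
Proof. by move=> c7; apply: val_inj; rewrite lo_tail //= inordK. Qed.

Lemma hi_tail2 c : (7 <= c)%N -> hi c = inord 2.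
Proof. by move=> c7; apply: val_inj; rewrite hi_tail //= inordK. Qed.

Lemma posc_twist c : posc c = (c < 7)%N.
Proof.
by rewrite /posc; case: ltnP => h; [rewrite lett_front | rewrite lett_tail].
Qed.

Lemma vertical_front s c : (c < 7)%N -> vertical s c = ~~ s c.
Proof. by move=> c7; rewrite /vertical posc_twist c7 eqbF_neg. Qed.

Lemma vertical_tail s c : (7 <= c)%N -> vertical s c = s c.
Proof. by move=> c7; rewrite /vertical posc_twist ltnNge c7 /= eqb_id. Qed.

(* Number of horizontally resolved tail crossings before level [t]. *)
Definition cnt s (t : nat) : nat := \sum_(7 <= i < t) ~~ s (lev i).
Definition nz s : nat := cnt s m.

Lemma cntS s t : (7 <= t)%N -> cnt s t.+1 = (cnt s t + ~~ s (lev t))%N.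
Proof. by move=> t7; rewrite /cnt big_nat_recr. Qed.

Lemma cnt_front s t : (t <= 7)%N -> cnt s t = 0%N.
Proof. by move=> t7; rewrite /cnt big_geq. Qed.

Lemma cnt_mono s t t' : (t <= t')%N -> (cnt s t <= cnt s t')%N.
Proof.
move=> tt'; have [t7|/ltnW t7] := leqP t 7; first by rewrite cnt_front.
by rewrite /cnt [leqRHS](big_cat_nat _ (n := t)) //= leq_addr.
Qed.

Lemma cnt_le s t : (t <= m)%N -> (cnt s t <= nz s)%N.
Proof. exact: cnt_mono. Qed.

Definition fbits s : seq bool := mkseq (fun t => if (t < 7)%N then s (lev t) else nz s == 0%N) 8.

Lemma size_fbits s : size (fbits s) = 8%N.
Proof. by rewrite size_mkseq. Qed.

Lemma nth_fbits s t : (t < 8)%N ->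
  nth false (fbits s) t = if (t < 7)%N then s (lev t) else nz s == 0%N.
Proof. by move=> t8; rewrite nth_mkseq. Qed.

Lemma fvertical_front s t : (t < 7)%N -> fvertical (fbits s) t = vertical s (lev t).
Proof.
move=> t7; have tm : (t < m)%N by apply: leq_trans m_ge7.
rewrite vertical_front ?val_lev // /fvertical nth_fbits ?t7; last by lia.
by rewrite (_ : (t == 7)%N = false) ?eqbF_neg //; lia.
Qed.

Lemma fvertical7 s : fvertical (fbits s) 7 = (nz s == 0%N).
Proof. by rewrite /fvertical nth_fbits //= eqb_id. Qed.

Definition cls s (q : nat) : nat := nth 0%N (classes (fbits s)) q.

(* Name of the circle through strand [p] at level [t]: a class of the front, or the
   number of a circle enclosed between two consecutive horizontal tail crossings. *)
Definition chi s (p t : nat) : nat + nat :=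
  if (t < 7)%N then inl (cls s (fv p t))
  else if p == 0%N then inl (cls s (fv 0 7))
  else if cnt s t == 0%N then inl (cls s (fv p 7))
  else if cnt s t == nz s then inl (cls s (fv p 0))
  else inr (cnt s t).

Definition chiv s u := chi s u.1 u.2.

Lemma cls_fcirc s p q : fcirc (fbits s) p q -> cls s p = cls s q.
Proof. by move/eqP. Qed.

Lemma chi_front s p t : (t <= 7)%N -> chi s p t = inl (cls s (fv p t)).
Proof.
rewrite leq_eqVlt => /orP[/eqP->|t7]; last by rewrite /chi t7.
by rewrite /chi ltnn cnt_front // eqxx; case: eqP => // ->.
Qed.

(** After the last horizontal tail crossing, names already refer to level 0; if there is none,
    crossing 7 of the front is vertical. *)
Lemma chi_m s p : (p < 3)%N -> chi s p m = chi s p 0.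
Proof.
move=> p3; rewrite [RHS]chi_front // /chi ltnNge m_ge7 /= -/(nz s).
have sz := size_fbits s; case: eqP => [->|p0].
  by rewrite (cls_fcirc (@fcirc_straight _ 7 sz isT)).
case: eqP => [n0|_]; last by rewrite eqxx.
by rewrite (cls_fcirc (@fcirc_vertical _ 7 p sz isT p3 _)) // fvertical7 n0.
Qed.

Lemma chi_mod s p t : (p < 3)%N -> (t <= m)%N -> chi s p (t %% m) = chi s p t.
Proof.
move=> p3; rewrite leq_eqVlt => /orP[/eqP->|/modn_small->//].
by rewrite modnn chi_m.
Qed.

Lemma chiv_vtx s p t : (p < 3)%N -> (t <= m)%N -> chiv s (vtx p t) = chi s p t.
Proof. by move=> p3 tm; rewrite /chiv /= inordK // chi_mod. Qed.

Lemma fnextE t : (t < 7)%N -> fnext t = t.+1.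
Proof. by rewrite /fnext; case: eqP => // ->. Qed.

Lemma chi_vertical s p c : (p < 3)%N ->
    vertical s c || ((p != lo c :> nat) && (p != hi c :> nat)) ->
  chi s p c = chi s p c.+1.
Proof.
move=> p3 h; case: (ltnP c 7) => c7; last first.
  have := h; rewrite vertical_tail // lo_tail // hi_tail // => h'.
  rewrite /chi !(@leq_gtF 7) ?leqW //=; case: eqP => // p0.
  rewrite cntS // lev_val; have -> : s c by case/orP: h' => // /andP[]; lia.
  by rewrite addn0.
rewrite !chi_front //; last by lia.
congr inl; rewrite -(fnextE c7); apply: cls_fcirc.
case/orP: h => [ver|]; first by rewrite fcirc_vertical ?size_fbits ?fvertical_front ?lev_val //; lia.
rewrite lo_front // hi_front // => /andP[h1 h2].
have -> : p = foth c by move: h1 h2; rewrite /foth /fhi /flo; case: (odd c) => /=; lia.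
by apply: fcirc_straight; [apply: size_fbits | lia].
Qed.

Lemma chi_horizontal s c : ~~ vertical s c ->
  chi s (lo c) c = chi s (hi c) c /\ chi s (lo c) c.+1 = chi s (hi c) c.+1.
Proof.
case: (ltnP c 7) => c7 hor.
  rewrite !chi_front; [|lia..]; rewrite lo_front // hi_front // -(fnextE c7).
  have [] := @fcirc_horizontal (fbits s) c; rewrite ?size_fbits ?fvertical_front ?lev_val //; first by lia.
  by move=> /cls_fcirc-> /cls_fcirc->.
move: hor; rewrite vertical_tail // lo_tail // hi_tail // => sc.
(* Before [c] lies the arc of E at level 7 or an enclosed circle, after [c] the arc at level 0 or
   the next enclosed circle; either way strands 1 and 2 share a name. *)
have cS : cnt s c.+1 = (cnt s c).+1 by rewrite cntS // lev_val sc addn1.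
have cnz : (cnt s c < nz s)%N by rewrite -cS; apply: cnt_le.
have [] := @fcirc_horizontal (fbits s) 7; rewrite ?size_fbits ?fvertical7 //; first by lia.
move=> /cls_fcirc; rewrite -/(fv 1 7) -/(fv 2 7) => E7.
move=> /cls_fcirc; rewrite -/(fv 1 0) -/(fv 2 0) => E0.
rewrite /chi !(@leq_gtF 7) ?leqW //= cS /=; split.
  by rewrite E7 (ltn_eqF cnz).
by rewrite E0.
Qed.

Lemma chi_level s c u v : level_edge s c u v -> chiv s u = chiv s v.
Proof.
have Ev (p : 'I_3) (t : 'I_m) : chiv s (p, t) = chi s p t by [].
have St (p : 'I_3) : chiv s (p, ordS c) = chi s p c.+1 by rewrite Ev /= chi_mod.
rewrite /level_edge; case/or3P.
- case/and4P=> n1 n2 /eqP-> /eqP->; rewrite Ev St.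
  by apply: chi_vertical => //; rewrite !val_eqE n1 n2 orbT.
- by case/andP=> ver /orP[] /andP[/eqP-> /eqP->]; rewrite Ev St;
    apply: chi_vertical => //; rewrite ver.
- by case/andP=> /chi_horizontal[h1 h2] /orP[] /andP[/eqP-> /eqP->]; rewrite ?St ?Ev.
Qed.

Lemma inord_eq p (i : 'I_3) : (p < 3)%N -> (inord p == i) = (p == i :> nat).
Proof. by move=> p3; rewrite -val_eqE /= inordK. Qed.

Lemma circ_step s p t : (p < 3)%N -> (7 <= t < m)%N -> (p == 0%N) || s (lev t) ->
  circ s (vtx p t) (vtx p t.+1).
Proof.
move=> p3 /andP[t7 tm]; have vt := val_lev tm; rewrite /vtx -ordS_lev.
case/orP=> [/eqP->|st]; last by apply: circ_vertical; rewrite vertical_tail // vt.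
by apply: circ_straight; rewrite inord_eq // ?lo_tail ?hi_tail // vt.
Qed.

Lemma circ_run s p t t' : (p < 3)%N -> (7 <= t)%N -> (t <= t' <= m)%N ->
  (p == 0%N) || (cnt s t == cnt s t') -> circ s (vtx p t) (vtx p t').
Proof.
move=> p3 t7 /andP[+ t'm]; elim: t' t'm => [|t' IH] t'm.
  by rewrite leqn0 => /eqP t0; rewrite t0 in t7.
rewrite leq_eqVlt => /orP[/eqP-> _|]; first exact: circ_refl.
rewrite ltnS => tt' h.
have c1 := cnt_mono s tt'; have c2 := cntS s (leq_trans t7 tt').
apply: (circ_trans (y := vtx p t')).
  apply: IH => //; first exact: ltnW.
  by case/orP: h => [->//|]; rewrite c2 => h; apply/orP; right; lia.
apply: circ_step => //; first by rewrite (leq_trans t7 tt').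
by case/orP: h => [->//|]; rewrite c2; case: (s _) => //=; lia.
Qed.

(** Follow both strands back to the nearest horizontal crossing, which joins them;
    [circ_rung_before] goes forward instead. *)
Lemma circ_rung_after s t : (7 <= t)%N -> (t <= m)%N -> (0 < cnt s t)%N ->
  circ s (vtx 1 t) (vtx 2 t).
Proof.
move=> t7 tm; elim: t t7 tm => // t IH.
rewrite leq_eqVlt => /orP[/eqP<-|]; first by rewrite cnt_front.
rewrite ltnS => t7 tm; have vt := val_lev tm; rewrite cntS //.
case st: (s (lev t)); rewrite /= ?addn0 => h.
  have H p : (p < 3)%N -> circ s (vtx p t) (vtx p t.+1).
    by move=> p3; apply: circ_step; rewrite ?t7 // st orbT.
  by rewrite -(circ_left (H 1%N isT)) -(circ_right (H 2%N isT)) IH // ltnW.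
have [] := @circ_horizontal _ s (lev t); first by rewrite vertical_tail ?vt ?st.
by move=> _; rewrite ordS_lev lo_tail1 ?hi_tail2 ?vt.
Qed.

Lemma circ_rung_before s t : (7 <= t)%N -> (cnt s t < nz s)%N ->
  circ s (vtx 1 t) (vtx 2 t).
Proof.
move=> t7 h; have tm : (t < m)%N.
  by rewrite ltnNge; apply: contraL h => mt; rewrite -leqNgt; apply: cnt_mono.
move: {2}(m - t)%N (erefl (m - t)%N) => d.
elim: d t t7 h tm => [|d IH] t t7 h tm E; first by lia.
have vt := val_lev tm; case st: (s (lev t)).
  have H p : (p < 3)%N -> circ s (vtx p t) (vtx p t.+1).
    by move=> p3; apply: circ_step; rewrite ?t7 // st orbT.
  rewrite (circ_left (H 1%N isT)) (circ_right (H 2%N isT)).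
  have cS : cnt s t.+1 = cnt s t by rewrite cntS // st addn0.
  apply: IH; rewrite ?cS //; try lia.
  have : t.+1 != m by apply: contraTneq h => tm'; rewrite -cS tm' ltnn.
  by move: tm; lia.
have [] := @circ_horizontal _ s (lev t); first by rewrite vertical_tail ?vt ?st.
by rewrite lo_tail1 ?hi_tail2 ?vt.
Qed.

End Twist.

(** * Completeness of the names of circles *)

Section Circles.
Variable k : nat.
Local Notation w := (twist_word k).
Local Notation m := (size w).
Implicit Types (s : resol w) (c : 'I_m) (u v : vert w) (l : labelling w).

Lemma fedges_lt bs e : e \in fedges bs -> (e.1 < 24)%N && (e.2 < 24)%N.
Proof.
case/flatten_mapP=> t; rewrite mem_iota add0n => /= t8.
rewrite /fedges_at /fv /foth /fnext /fhi /flo.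
by case: (odd t); case: (t =P 7%N) => t7; case: fvertical;
  rewrite !inE => /or3P[] /eqP-> /=; lia.
Qed.

Lemma lo_front_inord c : (c < 7)%N -> lo c = inord (flo c).
Proof. by move=> c7; apply: val_inj; rewrite lo_front //= inordK // /flo; case: odd. Qed.

Lemma hi_front_inord c : (c < 7)%N -> hi c = inord (fhi c).
Proof. by move=> c7; apply: val_inj; rewrite hi_front //= inordK // /fhi /flo; case: odd. Qed.

Lemma flo_lt3 t : (flo t < 3)%N. Proof. by rewrite /flo; case: odd. Qed.
Lemma fhi_lt3 t : (fhi t < 3)%N. Proof. by rewrite /fhi /flo; case: odd. Qed.
Lemma foth_lt3 t : (foth t < 3)%N. Proof. by rewrite /foth; case: odd. Qed.

(** Arcs at crossing 7 are realised by paths in the tail: full runs along strands or, for E, turns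
    at the first or last horizontal crossing. *)
Lemma fedges_circ s e : e \in fedges (fbits s) -> circ s (emb k e.1) (emb k e.2).
Proof.
case/flatten_mapP=> t; rewrite mem_iota add0n => /= t8.
have [t7|t7] := ltnP t 7.
  have tm : (t < m)%N := leq_trans t7 (m_ge7 k).
  have vt := val_lev tm; have c7 : (lev k t < 7)%N by rewrite vt.
  have eo := @inord_eq (foth t) _ (foth_lt3 t).
  rewrite /fedges_at fvertical_front // fnextE // inE => /orP[/eqP->|] /=.
    rewrite !emb_fv ?foth_lt3 // /vtx -ordS_lev; apply: circ_straight;
      rewrite eo ?lo_front ?hi_front // vt /foth /fhi /flo; by case: odd.
  case: ifPn => [ver|/circ_horizontal[]]; rewrite !inE.
    by case/orP=> /eqP-> /=; rewrite !emb_fv ?flo_lt3 ?fhi_lt3 // /vtx -ordS_lev;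
      apply: circ_vertical.
  rewrite lo_front_inord // hi_front_inord // vt ordS_lev => h1 h2.
  by case/orP=> /eqP-> /=; rewrite !emb_fv ?flo_lt3 ?fhi_lt3.
have -> : t = 7%N by lia.
have m7 := m_ge7 k.
rewrite /fedges_at fvertical7 /fnext /= inE => /orP[/eqP->|] /=.
  by rewrite !emb_fv //= -vtx_m; apply: circ_run => //; rewrite m7 leqnn.
case: eqP => [n0|/eqP n0]; rewrite !inE => /orP[] /eqP-> /=;
  rewrite !emb_fv //= -?vtx_m.
- by apply: circ_run; rewrite ?m7 ?leqnn // cnt_front // -/(nz s) n0.
- by apply: circ_run; rewrite ?m7 ?leqnn // cnt_front // -/(nz s) n0.
- by apply: circ_rung_before; rewrite // cnt_front // lt0n.
- by apply: circ_rung_after; rewrite // -/(nz s) lt0n.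
Qed.

Lemma fv_divmod q : fv (q %% 3) (q %/ 3) = q.
Proof. by rewrite /fv; lia. Qed.

Lemma chiv_emb s q : (q < 24)%N -> chiv s (emb k q) = inl (cls s q).
Proof.
move=> q24; have q7 : (q %/ 3 <= 7)%N by lia.
rewrite chiv_vtx ?ltn_mod //; last exact: leq_trans q7 (m_ge7 k).
by rewrite chi_front // fv_divmod.
Qed.

(** Names separate circles in one direction; in the other, union-find joins only points already
    joined in the long diagram. *)
Lemma circ_emb s q q' : (q < 24)%N -> (q' < 24)%N ->
  circ s (emb k q) (emb k q') = fcirc (fbits s) q q'.
Proof.
move=> q24 q'24; apply/idP/idP => [/(circ_inv (@chi_level _ s))|].
  by rewrite !chiv_emb // => -[]; rewrite /cls /fcirc => ->.
rewrite /fcirc /classes => /eqP; apply: (@merge_sound (fun x y => circ s (emb k x) (emb k y))) => //.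
  by move=> x y z; split; [apply: circ_refl | move=> xy; apply: (circ_left xy)].
by apply/allP=> e he; rewrite andbA (fedges_lt he) /= fedges_circ.
Qed.

Lemma chiv_front s u z : chiv s u = inl z ->
  exists q, [/\ (q < 24)%N, circ s u (emb k q) & cls s q = z].
Proof.
rewrite -{2}(vtx_val u) /chiv; case: u => p t /=; have p3 := ltn_ord p.
have tm : (t <= m)%N by apply: ltnW; apply: ltn_ord.
move: (nat_of_ord p) p3 (nat_of_ord t) tm => {}p p3 {}t tm; rewrite /chi.
have m7 := m_ge7 k.
case: ltnP => [t7 [<-]|t7].
  by exists (fv p t); rewrite emb_fv // circ_refl; split=> //; rewrite /fv; lia.
case: eqP => [->[<-]|p0].
  exists (fv 0 7); rewrite emb_fv //; split=> //.
  by rewrite circ_sym; apply: circ_run; rewrite // t7.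
case: eqP => [c0[<-]|c0].
  exists (fv p 7); rewrite emb_fv //; split=> //.
  by rewrite circ_sym; apply: circ_run; rewrite ?t7 // c0 cnt_front // orbT.
case: eqP => [cz[<-]|//].
exists (fv p 0); rewrite emb_fv //; split=> //; first by rewrite /fv; lia.
by rewrite -vtx_m; apply: circ_run; rewrite ?tm ?leqnn // cz eqxx orbT.
Qed.

Lemma chiv_closed s u a : chiv s u = inr a ->
  circ s u (vtx k 1 u.2) /\ [/\ (7 <= u.2)%N, (0 < a)%N, (a < nz s)%N & cnt s u.2 = a].
Proof.
rewrite -{2}(vtx_val u) /chiv; case: u => p t /=; have p3 := ltn_ord p.
have tm : (t <= m)%N by apply: ltnW; apply: ltn_ord.
move: (nat_of_ord p) p3 (nat_of_ord t) tm => {}p p3 {}t tm; rewrite /chi.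
case: ltnP => // t7; case: eqP => // p0; case: eqP => // /eqP c0; case: eqP => // /eqP cz [<-].
have cl := cnt_le s tm.
split; last by split=> //; rewrite ?lt0n // ltn_neqAle cz.
have [->|p1] := eqVneq p 1%N; first exact: circ_refl.
by rewrite (_ : p = 2) ?[circ s (vtx k 2 t) _]circ_sym ?circ_rung_after ?lt0n //; lia.
Qed.

(** A circle with a front name passes through a front point; an enclosed circle meets strand 1 in a
    run of levels with constant count. *)
Lemma circ_chi s u v : circ s u v = (chiv s u == chiv s v).
Proof.
apply/idP/eqP => [|E]; first exact: (circ_inv (@chi_level _ s)).
case Eu: (chiv s u) => [z|a]; have Ev := Eu; rewrite E in Ev.
  have [q [q24 uq cq]] := chiv_front Eu; have [q' [q'24 vq' cq']] := chiv_front Ev.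
  by rewrite (circ_left uq) (circ_right vq') circ_emb // /fcirc -/(cls s q) cq -cq'.
have [cu [u7 _ _ nu]] := chiv_closed Eu; have [cv [v7 _ _ nv]] := chiv_closed Ev.
rewrite (circ_left cu) (circ_right cv).
have lem t t' : (7 <= t)%N -> (t <= t')%N -> (t' < m)%N -> cnt s t = a -> cnt s t' = a ->
    circ s (vtx k 1 t) (vtx k 1 t').
  by move=> t7 tt' t'm h h'; apply: circ_run; rewrite // ?tt' ?(ltnW t'm) // h h' eqxx orbT.
case: (leqP u.2 v.2) => uv; first by apply: lem.
by rewrite circ_sym; apply: lem => //; apply: ltnW.
Qed.

End Circles.

(** * Flipping one crossing *)

Section Flips.
Variable k : nat.
Local Notation w := (twist_word k).
Local Notation m := (size w).
Implicit Types (s : resol w) (c : 'I_m) (u v : vert w) (l : labelling w).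

Lemma cnt_flip s c t : ~~ s c -> (t <= m)%N ->
  cnt s t = (cnt (flip s c) t + ((7 <= c) && (c < t)))%N.
Proof.
move=> sc; elim: t => [|t IH] tm; first by rewrite !cnt_front // ltn0 andbF.
have [t7|t7] := ltnP t 7.
  by rewrite !cnt_front // ltnS; case: (leqP 7 c) => //= c7; rewrite leqNgt (leq_trans t7 c7).
rewrite !cntS // IH ?(ltnW tm) // flipE lev_inj // -!addnA; congr addn.
have [tc|tc] := eqVneq t c.
  by move: t7; rewrite tc lev_val (negbTE sc) /= ltnn ltnSn => ->.
by rewrite /= addnC ltnS [(c <= t)%N]leq_eqVlt (eq_sym (c : nat)) (negbTE tc).
Qed.

Lemma nz_flip s c : ~~ s c -> nz s = (nz (flip s c) + (7 <= c))%N.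
Proof. by move=> sc; rewrite /nz (cnt_flip sc) // ltn_ord andbT. Qed.

Lemma fbits_flip_front s c : ~~ s c -> (c < 7)%N -> fbits (flip s c) = fflip (fbits s) c.
Proof.
move=> sc c7; apply: (@eq_from_nth _ false); rewrite ?size_fbits ?size_mkseq // => t t8.
rewrite nth_fbits // [RHS]nth_mkseq // nth_fbits // (nz_flip sc) (ltn_geF c7) addn0.
case: ifP => t7; last by rewrite (_ : (t == c) = false) //; apply/eqP=> tc; rewrite tc c7 in t7.
by rewrite flipE lev_inj // (leq_trans t7 (m_ge7 k)).
Qed.

(** The flip makes [c] vertical; the tail turns from E into I only if [c] was its sole horizontal
    crossing. *)
Lemma fbits_flip_tail s c : ~~ s c -> (7 <= c)%N ->
  fbits (flip s c) = if nz s == 1%N then fflip (fbits s) 7 else fbits s.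
Proof.
move=> sc c7; have nzE : nz s = (nz (flip s c)).+1 by rewrite (nz_flip sc) c7 addn1.
have fr t : (t < 7)%N -> flip s c (lev k t) = s (lev k t).
  move=> t7; rewrite flipE lev_inj ?(leq_trans t7 (m_ge7 k)) //.
  by rewrite (ltn_eqF (leq_trans t7 c7)).
apply: (@eq_from_nth _ false); first by rewrite size_fbits; case: ifP; rewrite ?size_fbits ?size_mkseq.
rewrite size_fbits => t t8; rewrite nzE eqSS; case: ifP => [n0|n1].
  rewrite nth_fbits // [RHS]nth_mkseq // nth_fbits //; case: ifP => t7; first by rewrite fr // (ltn_eqF t7).
  by rewrite (_ : t = 7%N) ?n0 //; lia.
by rewrite !nth_fbits //; case: ifP => t7; rewrite ?fr // n1 nzE.
Qed.

Definition lab l : seq bool := mkseq (fun q => l (emb k q)) 24.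

Lemma nth_lab l q : (q < 24)%N -> nth false (lab l) q = l (emb k q).
Proof. by move=> q24; rewrite nth_mkseq. Qed.

Lemma fe1_lt t : (t < 8)%N -> (fe1 t < 24)%N.
Proof. by rewrite /fe1 /fv /flo; case: odd => /=; lia. Qed.

Lemma fe2_lt bs t : (t < 8)%N -> (fe2 bs t < 24)%N.
Proof.
rewrite /fe2 /fv /fhi /flo /fnext; case: eqP => t7; case: fvertical; case: odd => /=; lia.
Qed.

(* Crossing [c] of the long diagram behaves as crossing [t] of the front. *)
Definition modelled s c t := [/\ (t < 8)%N, fbits (flip s c) = fflip (fbits s) t,
  circ s (e1 s c) (emb k (fe1 t)) /\ circ s (e2 s c) (emb k (fe2 (fbits s) t)) &
  circ (flip s c) (e1 (flip s c) c) (emb k (fe1 t)) /\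
  circ (flip s c) (e2 (flip s c) c) (emb k (fe2 (fbits (flip s c)) t))].

Section Modelled.
Variables (s : resol w) (c : 'I_m) (t : nat).
Hypothesis mod_sct : modelled s c t.

Lemma modelled_split : circ s (e1 s c) (e2 s c) = fcirc (fbits s) (fe1 t) (fe2 (fbits s) t).
Proof.
case: mod_sct => t8 _ [h1 h2] _.
by rewrite (circ_left h1) (circ_right h2) circ_emb ?fe1_lt ?fe2_lt.
Qed.

Lemma modelled_split_flip : circ (flip s c) (e1 (flip s c) c) (e2 (flip s c) c) =
  fcirc (fflip (fbits s) t) (fe1 t) (fe2 (fflip (fbits s) t) t).
Proof.
case: mod_sct => t8 bE _ [h1 h2].
by rewrite (circ_left h1) (circ_right h2) circ_emb ?fe1_lt ?fe2_lt // bE.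
Qed.

Lemma modelled_planar : ~~ nth false (fbits s) t ->
  circ s (e1 s c) (e2 s c) = ~~ circ (flip s c) (e1 (flip s c) c) (e2 (flip s c) c).
Proof.
have [t8 _ _ _] := mod_sct => st; rewrite modelled_split modelled_split_flip.
have /and4P[_ _ _ /allP/(_ t)] := front_classes (size_fbits s).
by rewrite mem_iota t8 (negbTE st) /= => /(_ isT); do 2!case: fcirc.
Qed.

Lemma modelled_ok l a b : valid (s, l) ->
  patch_ok s c l a b = fok (fbits s) (lab l) t a b.
Proof.
move=> /validP vl; have [t8 _ [h1 h2] _] := mod_sct.
rewrite /patch_ok /fok modelled_split_flip /edge_coef modelled_split.
by rewrite !nth_lab ?fe1_lt ?fe2_lt // (vl _ _ h1) (vl _ _ h2).
Qed.

Lemma modelled_patch l a b :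
  lab (patch (flip s c) c l a b) = fpatch (fflip (fbits s) t) (lab l) t a b.
Proof.
have [t8 bE _ [h1 h2]] := mod_sct.
apply: (@eq_from_nth _ false); rewrite !size_mkseq // => q q24.
rewrite !nth_mkseq // ffunE (circ_left h1) (circ_left h2).
by rewrite !circ_emb ?fe1_lt ?fe2_lt // -bE.
Qed.

End Modelled.

Lemma lev_next c t : val c = t -> ordS c = lev k t.+1.
Proof. by move=> <-; rewrite -ordS_lev lev_val. Qed.

Lemma modelled_front s c : ~~ s c -> (c < 7)%N -> modelled s c c.
Proof.
move=> sc c7; have c8 : (c < 8)%N by apply: ltnW.
have E1 s1 : e1 s1 c = emb k (fe1 c).
  by rewrite /e1 /fe1 emb_fv ?flo_lt3 // /vtx lo_front_inord // lev_val.
have E2 s1 : e2 s1 c = emb k (fe2 (fbits s1) c).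
  rewrite /e2 /fe2 fvertical_front // lev_val; case: ifP => _.
    by rewrite emb_fv ?fhi_lt3 // /vtx hi_front_inord // lev_val.
  by rewrite emb_fv ?flo_lt3 // /vtx lo_front_inord // fnextE // -(@lev_next c).
by split; rewrite ?E1 ?E2 //; [apply: fbits_flip_front | split; apply: circ_refl..].
Qed.

Section TailCrossing.
Variables (s : resol w) (c : 'I_m).
Hypotheses (sc : ~~ s c) (c7 : (7 <= c)%N).

Lemma tail_e1 s1 : e1 s1 c = vtx k 1 c.
Proof. by rewrite /e1 lo_tail1 // /vtx lev_val. Qed.

Lemma tail_e2 : e2 s c = vtx k 1 c.+1.
Proof. by rewrite /e2 vertical_tail // (negbTE sc) lo_tail1 // (@lev_next c c). Qed.

Lemma tail_e2_flip : e2 (flip s c) c = vtx k 2 c.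
Proof. by rewrite /e2 vertical_tail // flipE eqxx hi_tail2 // /vtx lev_val. Qed.

Lemma cnt_tailS : cnt s c.+1 = (cnt s c).+1.
Proof. by rewrite cntS // lev_val sc addn1. Qed.

Lemma cnt_tail_lt : (cnt s c < nz s)%N.
Proof. by rewrite -cnt_tailS; apply: cnt_le. Qed.

Lemma nz_tail : nz s = (nz (flip s c)).+1.
Proof. by rewrite (nz_flip sc) c7 addn1. Qed.

Lemma cnt_flip_tail t : (t <= m)%N -> cnt s t = (cnt (flip s c) t + (c < t))%N.
Proof. by move=> tm; rewrite (cnt_flip sc tm) c7. Qed.

Lemma cnt_flip_self : cnt (flip s c) c = cnt s c.
Proof. by rewrite (@cnt_flip_tail c) ?ltnn ?addn0 // ltnW. Qed.

(** All other tail crossings are vertical, so straight runs connect the ends of [c] to those of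
    crossing 7. *)
Lemma modelled_tail : nz s = 1%N -> modelled s c 7.
Proof.
move=> n1; have := cnt_tail_lt; rewrite n1 ltnS leqn0 => /eqP c0.
have := nz_tail; rewrite n1 => -[/esym n0].
have cm : (c < m)%N by [].
have m7 := m_ge7 k.
have bs7 : fvertical (fbits s) 7 = false by rewrite fvertical7 n1.
have bs'7 : fvertical (fbits (flip s c)) 7 by rewrite fvertical7 n0.
split; [by [] | by rewrite (fbits_flip_tail sc c7) n1 eqxx | |].
  rewrite tail_e1 tail_e2 /fe1 /fe2 bs7 !emb_fv //; split.
    by rewrite circ_sym; apply: circ_run; rewrite ?c7 ?(ltnW cm) // c0 cnt_front // orbT.
  by rewrite -vtx_m; apply: circ_run; rewrite ?(leqW c7) ?leqnn ?cm // cnt_tailS c0 -/(nz s) n1 orbT.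
rewrite tail_e1 tail_e2_flip /fe1 /fe2 bs'7 !emb_fv //.
by split; rewrite circ_sym; apply: circ_run; rewrite ?c7 ?(ltnW cm) //
  cnt_flip_self c0 cnt_front // orbT.
Qed.

Hypothesis nz2 : (1 < nz s)%N.

Lemma fbits_tail : fbits (flip s c) = fbits s.
Proof. by rewrite fbits_flip_tail // (gtn_eqF nz2). Qed.

Lemma cls_tail : cls (flip s c) =1 cls s.
Proof. by move=> q; rewrite /cls fbits_tail. Qed.

(** One of the two circles at [c] lies between [c] and another horizontal crossing, so it is
    enclosed and differs from the other. *)
Lemma tail_merge : circ s (e1 s c) (e2 s c) = false.
Proof.
rewrite tail_e1 tail_e2 circ_chi !chiv_vtx ?(ltnW (ltn_ord c)) //.
rewrite /chi !(@leq_gtF 7) ?(leqW c7) //= cnt_tailS /=; have h := cnt_tail_lt.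
rewrite (ltn_eqF h); case: (eqVneq (cnt s c) 0%N) => [->|c0].
  by rewrite (ltn_eqF nz2).
by case: ifP => // _; apply/eqP => -[]; lia.
Qed.

(** Another horizontal crossing, before or after [c], still joins strands 1 and 2. *)
Lemma tail_merge_flip : circ (flip s c) (e1 (flip s c) c) (e2 (flip s c) c).
Proof.
rewrite tail_e1 tail_e2_flip; have := nz_tail => h; have [c0|c0] := posnP (cnt s c).
  by apply: circ_rung_before; rewrite // cnt_flip_self c0; lia.
by apply: circ_rung_after; rewrite ?(ltnW (ltn_ord c)) // cnt_flip_self.
Qed.

End TailCrossing.

Lemma twist_planar : planar w.
Proof.
move=> s c sc; have [c7|c7] := ltnP c 7.
  apply: modelled_planar (modelled_front sc c7) _.
  by rewrite nth_fbits ?c7 ?lev_val // ltnW.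
have nzE := nz_tail sc c7; have [n1|n1] := eqVneq (nz s) 1%N.
  by apply: modelled_planar (modelled_tail sc c7 n1) _; rewrite nth_fbits //= n1.
by rewrite tail_merge ?tail_merge_flip //; lia.
Qed.

End Flips.

(** * The cocycle *)

Lemma sum_seqE (T : Type) (r : seq T) F : sum_seq r F = \sum_(i <- r) F i.
Proof. by elim: r => [|i r IH]; rewrite ?big_nil //= big_cons IH. Qed.

Lemma sum_seq_bool F : sum_seq [:: true; false] F = \sum_(a : bool) F a.
Proof. by rewrite big_bool /= addr0. Qed.

Section Cocycle.
Variable k : nat.
Local Notation w := (twist_word k).
Local Notation m := (size w).
Implicit Types (s : resol w) (c : 'I_m) (u v : vert w) (l : labelling w).

Definition ones s (t : nat) : nat := \sum_(0 <= i < t) s (lev k i).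

Lemma esign_ones s c : esign int s c = (-1) ^+ ones s c.
Proof.
rewrite /esign; congr (_ ^+ _); rewrite -sum1_card big_mkcond /= /ones big_mkord.
rewrite (big_ord_widen _ (fun i => s (lev k i) : nat) (ltnW (ltn_ord c))).
rewrite [RHS]big_mkcond /=; apply: eq_bigr => i _; rewrite lev_val inE.
by case: (i < c)%N; case: (s i).
Qed.

Lemma fweight_ones s t : (t <= 7)%N -> fweight (fbits s) t = ones s t.
Proof.
move=> t7; rewrite /fweight /ones -sum1_count big_mkcond /index_iota subn0.
rewrite !big_seq; apply: eq_bigr => i; rewrite mem_iota add0n /= => it.
have i7 : (i < 7)%N by lia.
by rewrite nth_fbits ?i7; [case: (s _) | lia].
Qed.

Lemma ones_cnt s t : (7 <= t)%N -> (ones s t + cnt s t = ones s 7 + (t - 7))%N.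
Proof.
elim: t => // t IH; rewrite leq_eqVlt => /orP[/eqP<-|]; first by rewrite cnt_front // subnn addn0.
rewrite ltnS => t7; rewrite cntS // subSn // addnS -IH // /ones big_nat_recr //=.
by case: (s _) => /=; lia.
Qed.

(** The weight [i.+1] is chosen to cancel the dependence of [esign] on the position of the flipped
    tail crossing. *)
Definition zero_sum s (t : nat) : nat := \sum_(7 <= i < t) ~~ s (lev k i) * i.+1.
Definition sgn s : int := (-1) ^+ zero_sum s m.

Lemma zero_sumS s t : (7 <= t)%N ->
  zero_sum s t.+1 = (zero_sum s t + ~~ s (lev k t) * t.+1)%N.
Proof. by move=> t7; rewrite /zero_sum big_nat_recr. Qed.

Lemma zero_sum_front s t : (t <= 7)%N -> zero_sum s t = 0%N.
Proof. by move=> t7; rewrite /zero_sum big_geq. Qed.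

Lemma zero_sum_flip s c t : ~~ s c -> (t <= m)%N ->
  zero_sum s t = (zero_sum (flip s c) t + ((7 <= c) && (c < t)) * c.+1)%N.
Proof.
move=> sc; elim: t => [|t IH] tm; first by rewrite !zero_sum_front // ltn0 andbF.
have [t7|t7] := ltnP t 7.
  by rewrite !zero_sum_front // ltnS; case: (leqP 7 c) => //= c7; rewrite leqNgt (leq_trans t7 c7).
rewrite !zero_sumS // IH ?(ltnW tm) // flipE lev_inj // -!addnA; congr addn.
have [tc|tc] := eqVneq t c.
  by move: t7; rewrite tc lev_val (negbTE sc) /= ltnn ltnSn => ->.
by rewrite /= addnC ltnS [(c <= t)%N]leq_eqVlt (eq_sym (c : nat)) (negbTE tc).
Qed.

Lemma sgn_exp_flip s c : ~~ s c ->
  zero_sum s m = (zero_sum (flip s c) m + (7 <= c) * c.+1)%N.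
Proof. by move=> sc; rewrite (zero_sum_flip sc) // ltn_ord andbT. Qed.

Lemma sgn_flip_front s c : ~~ s c -> (c < 7)%N -> sgn (flip s c) = sgn s.
Proof. by move=> sc c7; rewrite /sgn (sgn_exp_flip sc) (ltn_geF c7) mul0n addn0. Qed.

(** By [ones_cnt], [ones s c] equals [ones s 7 + (c - 7) - cnt s c]; adding the weight [c + 1] makes
    the dependence on [c] itself even. *)
Lemma tail_sign s c : ~~ s c -> (7 <= c)%N ->
  esign int s c * sgn (flip s c) = (-1) ^+ (fweight (fbits s) 7 + cnt s c) * sgn s.
Proof.
move=> sc c7; rewrite esign_ones /sgn (sgn_exp_flip sc) c7 mul1n -!exprD fweight_ones //.
have := ones_cnt s c7 => h.
have -> : (ones s 7 + cnt s c + (zero_sum (flip s c) m + c.+1) =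
  ones s c + zero_sum (flip s c) m + 2 * (cnt s c + 4))%N by move: c7 h; lia.
by rewrite [in RHS]exprD exprM sqrrN !expr1n mulr1.
Qed.

Definition closed_lev s (t : nat) : bool := (0 < cnt s t)%N && (cnt s t < nz s)%N.

Definition closed_minus s l : bool :=
  [forall t : 'I_m, closed_lev s t ==> ~~ l (vtx k 1 t)].

(** With [nz] of the [k] negative crossings 0-resolved, the homological degree is [fweight - nz];
    the first test selects degree 0. *)
Definition phi (x : estate w) : int :=
  if (fweight (fbits x.1) 7 == nz x.1) && closed_minus x.1 x.2
  then sgn x.1 * Phi (fbits x.1) (lab x.2) else 0.

Definition flip_sum s l c : int := \sum_a \sum_b
  (if patch_ok s c l a b then phi (flip s c, patch (flip s c) c l a b) else 0).

Lemma modelled_sum s l c t :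
    valid (s, l) -> modelled s c t ->
    (forall a b, closed_minus (flip s c) (patch (flip s c) c l a b) = closed_minus s l) ->
  flip_sum s l c =
    if (fweight (fflip (fbits s) t) 7 == nz (flip s c)) && closed_minus s l
    then sgn (flip s c) * fterm (fbits s) (lab l) t else 0.
Proof.
move=> vl md K; have [_ bE _ _] := md.
rewrite /flip_sum /fterm sum_seq_bool.
transitivity (\sum_a \sum_b (if fok (fbits s) (lab l) t a b then
    if (fweight (fflip (fbits s) t) 7 == nz (flip s c)) && closed_minus s l then
      sgn (flip s c) * Phi (fflip (fbits s) t) (fpatch (fflip (fbits s) t) (lab l) t a b)
    else 0 else 0)).
  apply: eq_bigr => a _; apply: eq_bigr => b _; rewrite (modelled_ok md) //.
  by rewrite /phi /= K bE (modelled_patch md).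
case: ifP => _; last by rewrite big1 // => a _; rewrite big1 // => b _; case: ifP.
rewrite mulr_sumr; apply: eq_bigr => a _; rewrite sum_seq_bool mulr_sumr.
by apply: eq_bigr => b _; case: ifP; rewrite ?mulr0.
Qed.

Lemma closed_chi s t p : (0 < p < 3)%N -> (t <= m)%N -> closed_lev s t -> chiv s (vtx k p t) = inr (cnt s t).
Proof.
case/andP=> p0 p3 tm /andP[h1 h2]; rewrite chiv_vtx //.
have t7 : (7 <= t)%N by rewrite leqNgt; apply: contraL h1 => t7; rewrite cnt_front // ltnW.
by rewrite /chi (leq_gtF t7) (gtn_eqF p0) (gtn_eqF h1) (ltn_eqF h2).
Qed.

(** A front flip relabels only circles through front points, and enclosed circles avoid these. *)
Lemma closed_minus_front s l c a b : ~~ s c -> (c < 7)%N ->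
  closed_minus (flip s c) (patch (flip s c) c l a b) = closed_minus s l.
Proof.
move=> sc c7; have [c8 _ _ [h1 h2]] := modelled_front sc c7.
apply: eq_forallb => t; have tm := ltnW (ltn_ord t).
have -> : closed_lev s t = closed_lev (flip s c) t.
  by rewrite /closed_lev (cnt_flip sc) // (nz_flip sc) (ltn_geF c7) /= !addn0.
case: (boolP (closed_lev _ _)) => //= cl; rewrite ffunE (circ_left h1) (circ_left h2).
by rewrite !circ_chi !chiv_emb ?fe1_lt ?fe2_lt // (@closed_chi _ _ 1).
Qed.

Lemma front_flip_sum s l c : valid (s, l) -> ~~ s c -> (c < 7)%N ->
  flip_sum s l c = if (fweight (fbits s) 7 == nz s - 1)%N && (0 < nz s)%N && closed_minus s l
    then sgn s * fterm (fbits s) (lab l) c else 0.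
Proof.
move=> vl sc c7; rewrite (modelled_sum vl (modelled_front sc c7)); last first.
  by move=> a b; apply: closed_minus_front.
rewrite sgn_flip_front // -fbits_flip_front //; congr (if _ && _ then _ else _).
rewrite !fweight_ones // [in RHS](nz_flip sc) (ltn_geF c7) addn0.
(* The total number of 1-resolved crossings grows by one and the tail is unchanged, so the growth is
   among the first seven. The test [0 < nz s] guards the truncated subtraction. *)
have -> : ones (flip s c) 7 = (ones s 7).+1; last by lia.
have := ones_cnt (flip s c) (m_ge7 k); have := ones_cnt s (m_ge7 k).
have -> : (ones (flip s c) m = (ones s m).+1)%N.
  rewrite /ones !big_mkord (bigD1 c) // [X in _ = X.+1](bigD1 c) // !lev_val.
  rewrite (eq_bigr (fun i : 'I_m => s (lev k i) : nat)).
    by rewrite flipE eqxx (negbTE sc).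
  by move=> i ic; rewrite lev_val flipE (negbTE ic).
rewrite -!/(nz _) (nz_flip sc) (ltn_geF c7); lia.
Qed.

End Cocycle.

(** * Flips in the tail *)

Section TailFlips.
Variable k : nat.
Local Notation w := (twist_word k).
Local Notation m := (size w).
Implicit Types (s : resol w) (c : 'I_m) (u v : vert w) (l : labelling w).

(** Take the crossing just before the first level whose count exceeds [a]. With [zero_uniq] this
    numbers the horizontal tail crossings from 0. *)
Lemma zero_exists s a : (a < nz s)%N ->
  exists c : 'I_m, [/\ (7 <= c)%N, ~~ s c & cnt s c = a].
Proof.
move=> anz; have ex : exists t, (a < cnt s t)%N by exists m.
case: (ex_minnP ex) => -[|t]; first by rewrite cnt_front.
move=> hS hmin; have ht : (cnt s t <= a)%N.
  by rewrite leqNgt; apply/negP=> /hmin; rewrite ltnn.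
have t7 : (7 <= t)%N by rewrite leqNgt; apply: contraTN hS => t7; rewrite cnt_front.
have tm : (t < m)%N by apply: (hmin m).
exists (lev k t); rewrite val_lev //; move: hS; rewrite cntS //.
by case: (s _) => /= h; split=> //; lia.
Qed.

Lemma cnt_zero_lt s c (t : nat) : ~~ s c -> (7 <= c)%N -> (c < t)%N = (cnt s c < cnt s t)%N.
Proof.
move=> sc c7; have [ct|tc] := ltnP c t; last by rewrite ltnNge (cnt_mono s tc).
by rewrite -cnt_tailS // (cnt_mono s ct).
Qed.

Lemma zero_uniq s c c' : ~~ s c -> (7 <= c)%N -> ~~ s c' -> (7 <= c')%N ->
  cnt s c = cnt s c' -> c = c'.
Proof.
move=> sc c7 sc' c'7 E; apply: val_inj => /=.
have := cnt_zero_lt c' sc c7; have := cnt_zero_lt c sc' c'7; rewrite E ltnn.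
by case: ltngtP.
Qed.

Lemma closed_minus_small s l : (nz s <= 1)%N -> closed_minus s l.
Proof. by move=> n1; apply/forallP=> t; apply/implyP; rewrite /closed_lev; lia. Qed.

Lemma single_flip_sum s l c : valid (s, l) -> ~~ s c -> (7 <= c)%N -> nz s = 1%N ->
  flip_sum s l c = if fweight (fbits s) 7 == 0%N
    then sgn (flip s c) * fterm (fbits s) (lab l) 7 else 0.
Proof.
move=> vl sc c7 n1; have nzE := nz_tail sc c7; have n0 : nz (flip s c) = 0%N by lia.
rewrite (modelled_sum vl (modelled_tail sc c7 n1)); last first.
  by move=> a b; rewrite !closed_minus_small // ?n1 ?n0.
by rewrite n0 closed_minus_small ?n1 // andbT.
Qed.

Definition merged s c l (z : bool) : labelling w :=
  [ffun v => if circ (flip s c) (vtx k 1 c) v then z else l v].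

Section SeveralZeros.
Variables (s : resol w) (l : labelling w) (c : 'I_m).
Hypotheses (vl : valid (s, l)) (sc : ~~ s c) (c7 : (7 <= c)%N) (nz2 : (1 < nz s)%N).
Local Notation s' := (flip s c).
Local Notation W := (fweight (fbits s) 7).

Let cm : (c <= m)%N. Proof. exact: ltnW. Qed.
Let nzE : nz s = (nz s').+1. Proof. exact: nz_tail. Qed.
Let d_lt : (cnt s c < nz s)%N. Proof. exact: cnt_tail_lt. Qed.
Let cntE t : (t <= m)%N -> cnt s t = (cnt s' t + (cnt s c < cnt s t))%N.
Proof. by move=> tm; rewrite -cnt_zero_lt // -cnt_flip_tail. Qed.

Lemma tail_flip_sum : flip_sum s l c =
  \sum_z (if mcoef (l (vtx k 1 c)) (l (vtx k 1 c.+1)) z then phi (s', merged s c l z) else 0).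
Proof.
have ok a b : patch_ok s c l a b = (a == b) && mcoef (l (vtx k 1 c)) (l (vtx k 1 c.+1)) a.
  by rewrite /patch_ok tail_merge_flip //= /edge_coef tail_merge // tail_e1 // tail_e2.
apply: eq_bigr => a _; rewrite (bigD1 a) //= big1 ?addr0 => [|b]; last first.
  by rewrite ok eq_sym => /negbTE->.
rewrite ok eqxx /=; case: ifP => // _; congr (phi (_, _)); apply/ffunP=> v.
by rewrite !ffunE -(circ_left (tail_merge_flip sc c7 nz2)) tail_e1 //; case: (circ _ _ _).
Qed.

Lemma phi_tail l' : phi (s', l') =
  if (W == nz s - 1)%N && closed_minus s' l' then sgn s' * Phi (fbits s) (lab l') else 0.
Proof. by rewrite /phi /= fbits_tail // nzE subn1. Qed.

Lemma chi_flip_self : chi s' 1 c =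
  if cnt s c == 0%N then inl (cls s (fv 1 7))
  else if cnt s c == (nz s).-1 then inl (cls s (fv 1 0)) else inr (cnt s c).
Proof. by rewrite /chi (leq_gtF c7) /= !cls_tail // cnt_flip_self // nzE. Qed.

Section MinusCircles.
Hypothesis cmin : closed_minus s l.

Let minus t : (t <= m)%N -> closed_lev s t -> l (vtx k 1 t) = false.
Proof.
rewrite leq_eqVlt => /orP[/eqP->|tm]; first by rewrite /closed_lev ltnn andbF.
move=> cl; have /forallP/(_ (lev k t)) := cmin; rewrite val_lev // cl /=.
exact: negbTE.
Qed.

Lemma merged_minus : closed_minus s' (merged s c l false).
Proof.
apply/forallP=> t; apply/implyP=> cl; rewrite ffunE; case: ifP => // _.
have tm := ltnW (ltn_ord t); rewrite minus //.
move: cl; rewrite /closed_lev; have := cntE tm; have := nzE; lia.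
Qed.

Lemma merged_clear q0 : (q0 < 24)%N -> circ s' (vtx k 1 c) (emb k q0) ->
  lab (merged s c l false) = fclear (fbits s) (lab l) q0.
Proof.
move=> q024 cq; apply: (@eq_from_nth _ false); rewrite !size_mkseq // => q q24.
by rewrite !nth_mkseq // ffunE (circ_left cq) circ_emb // fbits_tail.
Qed.

(** The first enclosed circle, labelled v_-, merges with the arc of E at level 7: the product is v_-
    if that arc carries v_+, and 0 otherwise. *)
Lemma first_flip_sum : cnt s c = 0%N -> flip_sum s l c =
  if (W == nz s - 1)%N then sgn s' *
    (if nth false (lab l) (fv 1 7) then Phi (fbits s) (fclear (fbits s) (lab l) (fv 1 7)) else 0)
  else 0.
Proof.
move=> c0; rewrite nth_lab // tail_flip_sum big_bool !phi_tail merged_minus andbT.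
rewrite (@minus c.+1) //; last by rewrite /closed_lev cnt_tailS // c0.
have /validP/(_ (vtx k 1 c) (emb k (fv 1 7)))-> // := vl; last first.
  rewrite emb_fv // circ_sym; apply: circ_run; rewrite ?c7 ?cm // c0 cnt_front //.
rewrite (@merged_clear (fv 1 7)) //; last first.
  by rewrite circ_chi chiv_vtx // chiv_emb // chi_flip_self c0 /= cls_tail.
by case: (l _) => /=; rewrite ?add0r ?mulr0; case: ifP.
Qed.

Lemma last_flip_sum : cnt s c = (nz s).-1 -> flip_sum s l c =
  if (W == nz s - 1)%N then sgn s' *
    (if nth false (lab l) (fv 1 0) then Phi (fbits s) (fclear (fbits s) (lab l) (fv 1 0)) else 0)
  else 0.
Proof.
move=> c0; rewrite nth_lab // tail_flip_sum big_bool !phi_tail merged_minus andbT.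
rewrite (@minus c) //; last by rewrite /closed_lev c0; lia.
have /validP/(_ (vtx k 1 c.+1) (emb k (fv 1 0)))-> // := vl; last first.
  rewrite emb_fv // -vtx_m; apply: circ_run; rewrite ?(leqW c7) ?leqnn ?ltn_ord //.
  by rewrite cnt_tailS // c0 -/(nz s); apply/eqP; lia.
rewrite (@merged_clear (fv 1 0)) //; last first.
  rewrite circ_chi chiv_vtx // chiv_emb // chi_flip_self c0 eqxx cls_tail //.
  by rewrite ifF //; lia.
by case: (l _) => /=; rewrite ?add0r ?mulr0; case: ifP.
Qed.

(** Both circles at [c] are enclosed, and v_- v_- = 0. *)
Lemma middle_flip_sum : cnt s c != 0%N -> cnt s c != (nz s).-1 -> flip_sum s l c = 0.
Proof.
move=> h1 h2; rewrite tail_flip_sum big1 // => z _.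
rewrite (@minus c) // ?(@minus c.+1) // /closed_lev ?cnt_tailS //; lia.
Qed.

End MinusCircles.

(* If an enclosed circle is labelled v_+, only the flips of the two crossings
   bounding it contribute, and they cancel: v_+ is the unit, so each of them just
   erases this circle. *)
Section PlusCircle.
Variable a : nat.
Hypotheses (a0 : (0 < a)%N) (anz : (a < nz s)%N).

(* Crossing [c] bounds the closed circle number [a], and [x] is the level of the
   circle on the other side of [c]. *)
Definition beside (x : nat) :=
  (a == (cnt s c).+1) && (x == c) || (a == cnt s c) && (x == c.+1).

Lemma beside_cnt x : beside x ->
  [/\ (7 <= x)%N, (x <= m)%N &
      (a = (cnt s c).+1 /\ cnt s x = cnt s c) \/ (a = cnt s c /\ cnt s x = (cnt s c).+1)].
Proof.
by case/orP=> /andP[/eqP aE /eqP ->]; split;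
  rewrite ?(leqW c7) ?cnt_tailS //; auto.
Qed.

Lemma chi_flip_inl p t z : (t <= m)%N -> chi s p t = inl z -> chi s' p t = inl z.
Proof.
move=> tm; have H := cntE tm; have nE := nzE; have dl := d_lt.
rewrite /chi; case: ifP => t7; first by rewrite cls_tail.
case: ifP => p0; first by rewrite cls_tail.
case: ifP => b0; first by rewrite cls_tail // ifT //; lia.
case: ifP => // bN; rewrite ifF; last by lia.
by rewrite ifT ?cls_tail //; lia.
Qed.

(** The merged circle consists of circle [a] and its neighbour through [x], so its points off circle
    [a] lie on the neighbour. *)
Lemma chi_beside x p t : beside x -> (t <= m)%N ->
  chi s p t != inr a -> chi s' p t = chi s' 1 c -> chi s p t = chi s 1 x.
Proof.
move=> bx tm; have H := cntE tm; have nE := nzE; have dl := d_lt.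
have [x7 xm xc] := beside_cnt bx; rewrite chi_flip_self.
have -> : chi s 1 x = if cnt s x == 0%N then inl (cls s (fv 1 7))
    else if cnt s x == nz s then inl (cls s (fv 1 0)) else inr (cnt s x).
  by rewrite /chi (leq_gtF x7).
case E: (chi s p t) => [z|b] => [_|].
  rewrite (chi_flip_inl tm E); case: ifP => d0.
    by rewrite ifT //; lia.
  case: ifP => // dN; rewrite ifF; last by lia.
  by rewrite ifT //; lia.
move: E; rewrite /chi; case: ifP => // t7; case: ifP => // p0.
case: ifP => // b0; case: ifP => // bN [<-] ba.
have {}ba : cnt s t <> a by move=> h; rewrite h eqxx in ba.
rewrite ifF; last by lia.
rewrite ifF; last by lia.
case: ifP => // d0; case: ifP => // dN bd.
have {bd} b'd : cnt s' t = cnt s c by case: bd.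
rewrite ifF; last by lia.
rewrite ifF; last by lia.
by rewrite (_ : cnt s t = cnt s x) //; lia.
Qed.

Lemma merged_other x v : beside x -> chiv s v != inr a ->
  merged s c l (l (vtx k 1 x)) v = l v.
Proof.
move=> bx va; rewrite ffunE; case: ifP => //; have [x7 xm _] := beside_cnt bx.
rewrite circ_chi chiv_vtx // => /eqP h; apply: (elimT (validP s l) vl).
rewrite circ_chi chiv_vtx //; apply/eqP/esym; apply: (chi_beside bx) => //.
exact: ltnW.
Qed.

Lemma merged_on x t : beside x -> (t <= m)%N -> closed_lev s t -> cnt s t = a ->
  merged s c l (l (vtx k 1 x)) (vtx k 1 t) = l (vtx k 1 x).
Proof.
move=> bx tm cl ta; have H := cntE tm; have [_ _ xc] := beside_cnt bx.
have t7 : (7 <= t)%N by rewrite leqNgt; apply: contraL a0 => h; rewrite -ta cnt_front // ltnW.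
rewrite ffunE circ_chi !chiv_vtx // ifT //; apply/eqP.
have E : cnt s' t = cnt s' c by rewrite cnt_flip_self //; lia.
by rewrite /chi (leq_gtF c7) (leq_gtF t7) /= E.
Qed.

(** Stated without [c], so that the contributions of the two crossings bounding circle [a] can be
    compared. *)
Definition others_minus : bool :=
  [forall t : 'I_m, closed_lev s t && (cnt s t != a) ==> ~~ l (vtx k 1 t)].

Lemma closed_minus_merged x : beside x ->
  closed_minus s' (merged s c l (l (vtx k 1 x))) = others_minus.
Proof.
move=> bx; have [x7 xm xc] := beside_cnt bx; have nE := nzE; have dl := d_lt.
have other (t : 'I_m) : closed_lev s t -> cnt s t != a ->
    merged s c l (l (vtx k 1 x)) (vtx k 1 t) = l (vtx k 1 t).
  by move=> cl ta; apply: merged_other => //; rewrite (@closed_chi _ _ _ 1) // ltnW.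
apply/forallP/forallP=> K t; apply/implyP; have tm := ltnW (ltn_ord t); have H := cntE tm.
  case/andP=> cl ta; rewrite -other //; apply: (implyP (K t)).
  move: cl ta; rewrite /closed_lev; lia.
move=> cl; have cls : closed_lev s t by move: cl; rewrite /closed_lev; lia.
have [ta|ta] := eqVneq (cnt s t) a; last by rewrite other //; apply: (implyP (K t)); rewrite cls.
rewrite merged_on //; have clx : closed_lev s x by move: cl; rewrite /closed_lev; lia.
have xltm : (x < m)%N.
  rewrite ltn_neqAle xm andbT; apply: contraTneq clx => ->.
  by rewrite /closed_lev -/(nz s) ltnn andbF.
have := K (lev k x); rewrite val_lev // clx /= => /implyP; apply; lia.
Qed.

Lemma lab_merged x : beside x -> lab (merged s c l (l (vtx k 1 x))) = lab l.
Proof.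
move=> bx; apply: (@eq_from_nth _ false); rewrite !size_mkseq // => q q24.
by rewrite !nth_lab // merged_other // chiv_emb.
Qed.

Variable t0 : nat.
Hypotheses (t0m : (t0 <= m)%N) (t0a : cnt s t0 = a) (t0p : l (vtx k 1 t0)).

Let cl0 : closed_lev s t0. Proof. by rewrite /closed_lev t0a a0. Qed.

Let plus t : (t <= m)%N -> closed_lev s t -> cnt s t = a -> l (vtx k 1 t).
Proof.
move=> tm cl ta; rewrite -(elimT (validP s l) vl (vtx k 1 t0)) //.
by rewrite circ_chi !(@closed_chi _ _ _ 1) // t0a ta.
Qed.

Lemma beside_flip_sum x : beside x -> flip_sum s l c =
  if (W == nz s - 1)%N && others_minus then sgn s' * Phi (fbits s) (lab l) else 0.
Proof.
move=> bx; rewrite tail_flip_sum -(closed_minus_merged bx) -(lab_merged bx) -phi_tail.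
(* As circle [a] carries the unit v_+, [mcoef] selects exactly the label of the neighbour. *)
rewrite (bigD1 (l (vtx k 1 x))) //= big1 ?addr0.
  case/orP: bx => /andP[/eqP aE /eqP->].
    by rewrite (@plus c.+1) ?cnt_tailS // /closed_lev ?cnt_tailS // -?aE ?a0 //; case: (l _).
  by rewrite (@plus c) // /closed_lev -?aE ?a0 //; case: (l _).
move=> z; case/orP: bx => /andP[/eqP aE /eqP->].
  by rewrite (@plus c.+1) ?cnt_tailS // /closed_lev ?cnt_tailS // -?aE ?a0 //; case: z; case: (l _).
by rewrite (@plus c) // /closed_lev -?aE ?a0 //; case: z; case: (l _).
Qed.

(** Circle [a] stays enclosed with label v_+, so [closed_minus] fails after the flip. *)
Lemma apart_flip_sum : a != (cnt s c).+1 -> a != cnt s c -> flip_sum s l c = 0.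
Proof.
move=> h1 h2; rewrite tail_flip_sum big1 // => z _; case: ifP => // _; rewrite phi_tail.
have H := cntE t0m; have nE := nzE; have dl := d_lt.
have t0lt : (t0 < m)%N.
  rewrite ltn_neqAle t0m andbT; apply: contraTneq anz => h.
  by rewrite -t0a h -/(nz s) ltnn.
have cl' : closed_lev s' t0 by rewrite /closed_lev; lia.
rewrite (_ : closed_minus _ _ = false) ?andbF //; apply/negbTE/negP.
move=> /forallP/(_ (lev k t0)); rewrite val_lev // cl' /= ffunE circ_chi.
rewrite (@closed_chi _ s' t0 1) // chiv_vtx // chi_flip_self.
rewrite ifF ?t0p //; case: ifP => // _; case: ifP => // _.
by apply/eqP=> E; have {E} : cnt s c = cnt s' t0 by [case: E]; lia.
Qed.

End PlusCircle.
End SeveralZeros.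
End TailFlips.

(** * The cocycle equation and the nonvanishing of both classes *)

Section Assembly.
Variable k : nat.
Local Notation w := (twist_word k).
Local Notation m := (size w).
Implicit Types (s : resol w) (c : 'I_m) (u v : vert w) (l : labelling w).

Lemma front_total s l : valid (s, l) ->
  \sum_(c | ~~ s c && (c < 7)%N) esign int s c * flip_sum s l c =
  if (fweight (fbits s) 7 == nz s - 1)%N && (0 < nz s)%N && closed_minus s l
  then sgn s * front_sum (fbits s) (lab l) else 0.
Proof.
move=> vl; transitivity (\sum_(c | ~~ s c && (c < 7)%N) esign int s c *
    (if (fweight (fbits s) 7 == nz s - 1)%N && (0 < nz s)%N && closed_minus s l
     then sgn s * fterm (fbits s) (lab l) c else 0)).
  by apply: eq_bigr => c /andP[sc c7]; rewrite front_flip_sum.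
case: ifP => _; last by rewrite big1 // => c _; rewrite mulr0.
rewrite /front_sum sum_seqE big_filter mulr_sumr.
rewrite -[iota 0 7]/(index_iota 0 7) big_mkord.
rewrite (big_ord_widen_cond m (fun i => ~~ nth false (fbits s) i) (fun i =>
  sgn s * ((-1) ^+ fweight (fbits s) i * fterm (fbits s) (lab l) i)) (m_ge7 k)).
apply: eq_big => [c|c /andP[sc c7]].
  by case: ltnP; rewrite ?andbF // !andbT => c7; rewrite nth_fbits ?c7 ?lev_val // ltnW.
by rewrite esign_ones -fweight_ones 1?ltnW // mulrCA.
Qed.

Lemma front_equation s l : valid (s, l) -> (0 < nz s)%N ->
  front_sum (fbits s) (lab l) +
    (-1) ^+ fweight (fbits s) 7 * tail_sum (fbits s) (lab l) = 0.
Proof.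
move=> vl nz0; have sz := size_fbits s.
have /and4P[/eqP sz24 _ /allP idem _] := front_classes sz.
have := front_cocycle sz; rewrite /check_cocycle nth_fbits //= (gtn_eqF nz0) /=.
set tb := classes _ in sz24 idem *.
(* The bits are the labels at the class names; validity of [l] makes the enumerated labelling agree
   with [lab l] at every point. *)
have := @allbitsP _ [seq nth false (lab l) q | q <- undup tb] (size_map _ _).
move=> Hb /allP/(_ _ Hb); set lab' := labelling_of _ _.
suff -> : lab' = lab l by move/eqP.
apply: (@eq_from_nth _ false); rewrite size_map sz24 ?size_mkseq // => q q24.
rewrite (nth_map 0%N) ?sz24 //.
have inu : nth 0%N tb q \in undup tb by rewrite mem_undup mem_nth ?sz24.
rewrite (nth_map 0%N) ?index_mem // nth_index //.
have /andP[h1 h2] : (nth 0%N tb q < 24)%N && (nth 0%N tb (nth 0%N tb q) == nth 0%N tb q).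
  by apply: idem; rewrite mem_iota.
by rewrite !nth_lab //; apply: (elimT (validP s l) vl); rewrite circ_emb.
Qed.

Lemma flip_sum0 s l c : valid (s, l) -> ~~ s c -> (7 <= c)%N ->
  fweight (fbits s) 7 != (nz s - 1)%N -> flip_sum s l c = 0.
Proof.
move=> vl sc c7 /negbTE nW; have nE := nz_tail sc c7.
have [n1|n1] := eqVneq (nz s) 1%N.
  by rewrite single_flip_sum //; rewrite n1 in nW; rewrite nW.
have n2 : (1 < nz s)%N by lia.
rewrite tail_flip_sum // big1 // => z _.
by case: ifP => // _; rewrite phi_tail // nW.
Qed.

Lemma sum_front_tail s (F : 'I_m -> int) : \sum_(c | ~~ s c) F c =
  \sum_(c | ~~ s c && (c < 7)%N) F c + \sum_(c | ~~ s c && (7 <= c)%N) F c.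
Proof.
rewrite (bigID (fun c : 'I_m => c < 7)%N) /=; congr (_ + _).
by apply: eq_bigl => c; rewrite -leqNgt.
Qed.

Lemma tail_two s l c1 c2 (X1 X2 : int) :
    ~~ s c1 -> (7 <= c1)%N -> ~~ s c2 -> (7 <= c2)%N -> (cnt s c1 < cnt s c2)%N ->
    (forall c, ~~ s c -> (7 <= c)%N -> cnt s c != cnt s c1 -> cnt s c != cnt s c2 ->
       flip_sum s l c = 0) ->
    flip_sum s l c1 = sgn (flip s c1) * X1 -> flip_sum s l c2 = sgn (flip s c2) * X2 ->
  \sum_(c | ~~ s c && (7 <= c)%N) esign int s c * flip_sum s l c =
  (-1) ^+ fweight (fbits s) 7 * sgn s * ((-1) ^+ cnt s c1 * X1 + (-1) ^+ cnt s c2 * X2).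
Proof.
move=> s1 c17 s2 c27 lt12 H E1 E2.
have n12 : c2 != c1 by apply: contraTneq lt12 => ->; rewrite ltnn.
rewrite (bigD1 c1) /=; last by rewrite s1.
rewrite (bigD1 c2) /=; last by rewrite s2 c27.
rewrite big1 ?addr0; last first.
  move=> c /andP[/andP[/andP[sc c7] n1] n2]; rewrite H ?mulr0 //.
    by apply: contra_neq n1 => /(zero_uniq sc c7 s1 c17).
  by apply: contra_neq n2 => /(zero_uniq sc c7 s2 c27).
rewrite E1 E2 !mulrA !tail_sign //; move: (fweight _ 7) => W; rewrite !exprD mulrDr.
by congr (_ + _); rewrite -!mulrA; congr (_ * _); rewrite mulrCA.
Qed.

Lemma phi_cocycle_valid s l : valid (s, l) ->
  \sum_(c | ~~ s c) esign int s c * flip_sum s l c = 0.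
Proof.
move=> vl; rewrite sum_front_tail front_total //.
set W := fweight _ 7.
have [nz0|nz0] := posnP (nz s).
  rewrite nz0 andbF /= add0r big1 // => c /andP[sc c7].
  by have := nz_tail sc c7; rewrite nz0.
have [WE|nW] := eqVneq W (nz s - 1)%N; last first.
  by rewrite /= add0r big1 // => c /andP[sc c7]; rewrite flip_sum0 ?mulr0.
have [K|nK] := boolP (closed_minus s l); last first.
  rewrite /= add0r; have n2 : (1 < nz s)%N.
    by rewrite ltnNge; apply: contra nK => /closed_minus_small.
  (* The crossings with counts [a - 1] and [a] on the two sides of the v_+ circle give equal terms
     with opposite signs. *)
  case/forallPn: nK => t; rewrite negb_imply negbK => /andP[cl lt].
  have tm := ltnW (ltn_ord t); case/andP: (cl); set a := cnt s t => a0 anz.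
  have [c1 [c17 s1 e1]] := @zero_exists _ s a.-1 (leq_ltn_trans (leq_pred _) anz).
  have [c2 [c27 s2 e2]] := zero_exists anz.
  have aE : a = (cnt s c1).+1 by rewrite e1 prednK.
  pose X := if others_minus s l a then Phi (fbits s) (lab l) else 0.
  have b1 : beside s c1 a c1 by rewrite /beside aE !eqxx.
  have b2 : beside s c2 a c2.+1 by rewrite /beside e2 !eqxx orbT.
  rewrite (@tail_two s l c1 c2 X X) //.
  - by rewrite e2 aE exprS mulN1r mulNr subrr mulr0.
  - by rewrite e1 e2 prednK.
  - move=> c sc c7; rewrite e1 e2 => h1 h2.
    apply: (apart_flip_sum vl sc c7 n2 a0 anz tm (erefl a) lt).
      by apply: contra_neq h1 => ->.
    by rewrite eq_sym.
  - rewrite (beside_flip_sum vl s1 c17 n2 a0 anz tm (erefl a) lt b1) -/W WE eqxx /= /X.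
    by case: ifP; rewrite ?mulr0.
  rewrite (beside_flip_sum vl s2 c27 n2 a0 anz tm (erefl a) lt b2) -/W WE eqxx /= /X.
  by case: ifP; rewrite ?mulr0.
have eqn := front_equation vl nz0.
(* A single horizontal crossing gives the saddle E -> I. *)
have [n1|n1] := eqVneq (nz s) 1%N.
  have [c [c7 sc e]] := zero_exists nz0.
  have W0 : W = 0%N by rewrite WE n1.
  rewrite (big_pred1 c) => [|c']; last first.
    apply/andP/eqP=> [[sc' c'7]|-> //].
    have E : cnt s c' = cnt s c by have := cnt_tail_lt sc' c'7; rewrite n1 e; lia.
    exact: zero_uniq E.
  rewrite single_flip_sum // -/W W0 eqxx mulrA tail_sign // -/W W0 e expr0 mul1r.
  by move: eqn; rewrite /tail_sum -/W W0 eqxx expr0 mul1r -mulrDr => ->; rewrite mulr0.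
(* The first and last horizontal crossings give the two terms of E -> E; their counts 0 and
   [nz s - 1 = W] produce the signs in [tail_sum]. *)
have n2 : (1 < nz s)%N by lia.
have [c1 [c17 s1 e1]] := zero_exists nz0.
have anz : ((nz s).-1 < nz s)%N by rewrite prednK.
have [c2 [c27 s2 e2]] := zero_exists anz.
pose bs := fbits s.
pose X q := if nth false (lab l) q then Phi bs (fclear bs (lab l) q) else 0.
rewrite (@tail_two s l c1 c2 (X (fv 1 7)) (X (fv 1 0))) //.
- rewrite -/W e1 e2 -subn1 -WE expr0 mul1r.
  move: eqn; rewrite /tail_sum -/W ifF; last by lia.
  by move=> eqn; rewrite [_ * sgn s]mulrC -mulrA -mulrDr eqn mulr0.
- by rewrite e1 e2; lia.
- by move=> c sc c7; rewrite e1 e2 => h1 h2; apply: middle_flip_sum.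
- by rewrite first_flip_sum // -/W WE eqxx.
- by rewrite last_flip_sum // -/W WE eqxx.
Qed.

Lemma phi_cocycle (x : estate w) : \sum_y dcoef int x y * phi y = 0.
Proof.
case: (boolP (valid x)) => vx; last first.
  by rewrite big1 // => y _; rewrite /dcoef (negbTE vx) mul0r.
by rewrite sum_dcoef //; case: x vx => s l; apply: phi_cocycle_valid.
Qed.

(** Every crossing is vertical and every label v_-, which selects the first row of the table. *)
Lemma phi_psi : phi (psi_state w) = 1.
Proof.
have tail_s t : (7 <= t < m)%N -> s_or w (lev k t).
  by case/andP=> t7 tm; rewrite ffunE posc_twist val_lev // -leqNgt.
have cnt0 t : (t <= m)%N -> cnt (s_or w) t = 0%N.
  elim: t => [|t IH] tm; first by rewrite cnt_front.
  have [t7|t7] := ltnP t 7; first by rewrite cnt_front.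
  by rewrite cntS // IH ?(ltnW tm) // tail_s ?t7.
have nz0 : nz (s_or w) = 0%N by apply: cnt0.
have bs0 : fbits (s_or w) = [:: false; false; false; false; false; false; false; true].
  apply: (@eq_from_nth _ false); rewrite ?size_fbits // => t t8.
  rewrite nth_fbits // nz0; case: ifP => t7; last by rewrite (_ : t = 7%N) //; lia.
  have tm := leq_trans t7 (m_ge7 k).
  by rewrite ffunE posc_twist val_lev // t7; case: t t7 {t8 tm} => [|[|[|[|[|[|[]]]]]]].
have lab0 : lab (psi_state w).2 = nseq 24 false.
  by apply: (@eq_from_nth _ false); rewrite ?size_mkseq ?size_nseq // => q q24;
    rewrite nth_lab // ffunE nth_nseq q24.
have zs0 t : (t <= m)%N -> zero_sum (s_or w) t = 0%N.
  elim: t => [|t IH] tm; first by rewrite zero_sum_front.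
  have [t7|t7] := ltnP t 7; first by rewrite zero_sum_front.
  by rewrite zero_sumS // IH ?(ltnW tm) // tail_s ?t7.
by rewrite /phi nz0 closed_minus_small ?nz0 // lab0 /sgn zs0 //= bs0 expr0 mul1r.
Qed.

End Assembly.

(** Lets the integral cocycle [phi] be reduced to a cocycle over any [R]. *)
Lemma dcoef_int (w : seq letter) (R : nzRingType) (x y : estate w) :
  dcoef R x y = (dcoef int x y)%:~R.
Proof.
rewrite /dcoef; case: ifP => // _; rewrite rmorph_sum; apply: eq_bigr => c _ /=.
by rewrite rmorphM /= /esign rmorphXn /= rmorphN1 [in RHS]natz -pmulrn.
Qed.

Lemma twist_nonboundary k (R : nzRingType) :
  ~ (exists f : chain (twist_word k) R, forall z, khd f z = @psi (twist_word k) R z).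
Proof.
apply: (@cocycle_nonboundary _ _ (fun x => (phi x)%:~R)) => [x|].
  rewrite (eq_bigr (fun y => (dcoef int x y * phi y)%:~R)).
    by rewrite -(rmorph_sum intr) phi_cocycle.
  by move=> y _; rewrite dcoef_int -intrM.
by rewrite phi_psi.
Qed.

Theorem theorem3p1 (k : nat) :
  psi_nonzero (twist_word k) rat /\
  psi_nonzero (twist_word k) int /\
  psi_nonzero (twist_word k) 'F_2 /\
  (forall v0 : vert (twist_word k), @psi'_nonzero (twist_word k) 'F_2 v0).
Proof.
have nb R : psi_nonzero (twist_word k) R.
  by split; [apply: psi_cycle | apply: twist_nonboundary].
do 3!(split; first exact: nb); move=> v0.
split; first exact: (psi'_cycle (@twist_planar k)).
exact: (psi'_nonboundary (@twist_planar k) (@twist_nonboundary k _)).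
Qed.
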